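(* Let $N\ge2$ be an integer, let $B\subset\mathbb{R}^N$ be the open unit ball, and for $\lambda,\delta>0$ consider the problem $$(P_\lambda)\qquad -\Delta U=\frac{\lambda+\delta|\nabla U|^2}{1-U},\quad U>0\ \text{ in } B,\qquad U=0\ \text{ on }\partial B .$$ (i) Assume $\delta>0$. If $(P_\lambda)$ has a regular solution, then $$\lambda<\min\left\{\frac{\mu_1}{4},\frac{\mu_1}{\delta}\right\},$$ where $\mu_1>0$ is the first eigenvalue of the Dirichlet Laplacian on $B$. (ii) Assume $\delta\ge N/2$. Then there exists $\bar\lambda>0$ such that $(P_\lambda)$ has exactly two radial regular solutions for each $\lambda\in(0,\bar\lambda)$, exactly one radial regular solution for $\lambda=\bar\lambda$, and no radial regular solution for $\lambda>\bar\lambda$. Moreover, $$\bar\lambda\ge N\left(\frac{2}{\delta+1}\right)^{(\delta+1)/(\delta-1)}.$$ (iii) Assume $\delta=N/2$. Then all the radial regular solutions of $(P_\lambda)$ (over all $\lambda>0$) can be described as $$(\lambda,U(r))=\bigl(2N\alpha(1-\alpha),\ \alpha(1-r^2)\bigr),\qquad 0<\alpha<1 .$$ In particular, $(P_\lambda)$ has exactly two radial regular solutions for each $\lambda\in(0,N/2)$, exactly one radial regular solution for $\lambda=N/2$, and no radial regular solution for $\lambda>N/2$.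
   Context: A regular solution of $(P_\lambda)$ is a (classical) solution with $0<U<1$ in $B$; it is radial if $U=U(r)$ with $r=|x|$.
   Formalization: In the lower bound of (ii) the exponent (δ+1)/(δ−1) is undefined for δ=1 (possible only when N=2); there the bound is read as its limit as δ→1, namely N/e. For δ≠1 the bound is as printed. *)

(* Defs.v *)
From mathcomp Require Import all_boot all_order all_algebra.
From mathcomp Require Import all_classical all_reals all_analysis.

Set Implicit Arguments.
Unset Strict Implicit.
Unset Printing Implicit Defensive.

Import Order.TTheory GRing.Theory Num.Theory.
Import numFieldNormedType.Exports.

Local Open Scope classical_set_scope.
Local Open Scope ring_scope.

(* The norm `|x| that the library puts on 'rV[R]_N is the sup norm; its
   topology is the usual one, but the unit ball needs the Euclidean norm. *)
Definition enorm (R : realType) (N : nat) (x : 'rV[R]_N) : R :=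
  Num.sqrt (\sum_(i < N) x ord0 i ^+ 2).

Definition unit_ball (R : realType) (N : nat) : set 'rV[R]_N :=
  [set x | enorm x < 1].

Definition closed_unit_ball (R : realType) (N : nat) : set 'rV[R]_N :=
  [set x | enorm x <= 1].

Definition unit_sphere (R : realType) (N : nat) : set 'rV[R]_N :=
  [set x | enorm x = 1].

Definition partial (R : realType) (N : nat) (i : 'I_N) (U : 'rV[R]_N -> R) :
  'rV[R]_N -> R := fun x => 'D_(delta_mx ord0 i) U x.

Definition laplacian (R : realType) (N : nat) (U : 'rV[R]_N -> R)
  (x : 'rV[R]_N) : R := \sum_(i < N) partial i (partial i U) x.

Definition gradient (R : realType) (N : nat) (U : 'rV[R]_N -> R)
  (x : 'rV[R]_N) : 'rV[R]_N := \row_(i < N) partial i U x.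

(* D is meant to be open. *)
Definition C1_on (R : realType) (N : nat) (D : set 'rV[R]_N)
  (U : 'rV[R]_N -> R) : Prop :=
  forall (i : 'I_N) (x : 'rV[R]_N), D x ->
    derivable U x (delta_mx ord0 i) /\ {for x, continuous (partial i U)}.

Definition C2_on (R : realType) (N : nat) (D : set 'rV[R]_N)
  (U : 'rV[R]_N -> R) : Prop :=
  C1_on D U /\ forall i : 'I_N, C1_on D (partial i U).

(* The class C^2(B) \cap C(closure of B) with zero boundary values. Functions
   are total on 'rV[R]_N, but only their values on the closed ball matter. *)
Definition dirichlet_class (R : realType) (N : nat) (U : 'rV[R]_N -> R) : Prop :=
  [/\ C2_on (@unit_ball R N) U,
      {within @closed_unit_ball R N, continuous U}
    & forall x, unit_sphere x -> U x = 0].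

Definition dirichlet_eigenvalue (R : realType) (N : nat) (mu : R) : Prop :=
  exists phi : 'rV[R]_N -> R,
    [/\ dirichlet_class phi,
        exists x, unit_ball x /\ phi x <> 0
      & forall x, unit_ball x -> - laplacian phi x = mu * phi x].

Definition first_dirichlet_eigenvalue (R : realType) (N : nat) (mu : R) : Prop :=
  dirichlet_eigenvalue N mu /\
  forall nu : R, dirichlet_eigenvalue N nu -> mu <= nu.

Definition regular_solution (R : realType) (N : nat) (lambda delta : R)
  (U : 'rV[R]_N -> R) : Prop :=
  [/\ dirichlet_class U,
      forall x, unit_ball x -> 0 < U x < 1
    & forall x, unit_ball x ->
        - laplacian U x =
        (lambda + delta * enorm (gradient U x) ^+ 2) / (1 - U x)].

Definition radial (R : realType) (N : nat) (U : 'rV[R]_N -> R) : Prop :=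
  exists u : R -> R, forall x, closed_unit_ball x -> U x = u (enorm x).

Definition radial_regular_solution (R : realType) (N : nat) (lambda delta : R)
  (U : 'rV[R]_N -> R) : Prop :=
  regular_solution lambda delta U /\ radial U.

(* Functions on the closed ball are represented by total functions, hence
   solutions are counted up to equality on the closed ball. *)
Definition same_on_ball (R : realType) (N : nat) (U V : 'rV[R]_N -> R) : Prop :=
  forall x, closed_unit_ball x -> U x = V x.

Definition exactly_one (R : realType) (N : nat)
  (P : ('rV[R]_N -> R) -> Prop) : Prop :=
  exists U, P U /\ forall W, P W -> same_on_ball W U.

Definition exactly_two (R : realType) (N : nat)
  (P : ('rV[R]_N -> R) -> Prop) : Prop :=
  exists U V, [/\ P U, P V, ~ same_on_ball U V
    & forall W, P W -> same_on_ball W U \/ same_on_ball W V].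

(* N (2/(delta+1))^((delta+1)/(delta-1)). The case delta = 1, which occurs
   only for N = 2, is read as the limit delta -> 1, that is N / e; the total
   division would make the exponent 0 there. *)
Definition lambda_lower_bound (R : realType) (N : nat) (delta : R) : R :=
  if delta == 1 then N%:R * expR (- 1)
  else N%:R * (2 / (delta + 1)) `^ ((delta + 1) / (delta - 1)).

(* Main.v *)
(* Part (i). If V > 0 on the closed ball and - Laplacian V > nu V in B, then
   every Dirichlet eigenvalue exceeds nu: look at a maximum point of phi / V.
   For a solution U take V = (exp (delta U) - 1) / delta + k with k = 1 / delta,
   which gives lambda delta < mu_1, and with k > 0 small, which gives
   4 lambda < mu_1.

   Parts (ii) and (iii). For t = 1 - U the radial equation becomes
   t (t'' + (N - 1) t' / r) = lambda + delta t'^2. If T is its solution with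
   lambda = 1, T(0) = 1 and T'(0) = 0, then by scaling and uniqueness all radial
   solutions are t(r) = T(rho r) / T(rho), with lambda = (rho / T(rho))^2, so
   they are counted by the level sets of rho / T(rho). A Pohozaev-type identity
   shows for delta >= N / 2 that T' / r is nondecreasing; hence T - rho T'
   strictly decreases to minus infinity and rho / T(rho) increases from 0 to a
   maximum and then decreases to 0. For delta = N / 2 one has
   T = 1 + r^2 / (2 N). For delta > N / 2 one has delta > 1 and
   T = w^(-1 / (delta - 1)),
   where w solves w'' + (N - 1) w' / r = - (delta - 1) w^((delta + 1) / (delta - 1)),
   a Lipschitz equation on the range [0, 1] of w, solved by Picard iteration.
   Since w >= 1 - (delta - 1) r^2 / (2 N), evaluating rho / T(rho) at
   rho^2 = 2 N / (delta + 1) gives the lower bound on the maximum. *)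

Require Import Defs.
From mathcomp Require Import all_boot all_order all_algebra.
From mathcomp Require Import all_classical all_reals all_analysis.
From mathcomp Require Import ring lra.

Import Order.TTheory GRing.Theory Num.Theory.
Import numFieldNormedType.Exports.

Local Open Scope classical_set_scope.
Local Open Scope ring_scope.

Set Implicit Arguments.
Unset Strict Implicit.
Unset Printing Implicit Defensive.

(** * One-variable calculus *)

(** The substitution T = w^(-b) is dictated by the gradient term: the multiples of w'^2 in T T'' and
    delta T'^2 are b (b + 1) and delta b^2, and they cancel exactly for b = 1 / (delta - 1), leaving
    the power 1 + 2 b > 1 of w. At delta = 1 this b degenerates, but then N = 2 and delta = N / 2,
    where T is explicit. In the eigenvalue bounds the constant k keeps V positive up to the sphere,
    so that phi / V attains its maximum on the compact ball; the 4 comes from 4 u (1 - u) <= 1.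

    T may blow up at a finite radius. The counting therefore uses S = 1 / T, continued by 0: rho
    S(rho) is then continuous on the whole half-line, and the cases with and without blow-up need no
    separate treatment.

    The other obstacle is r = 0, where T' / r is singular. Such a quotient is replaced by the
    Caratheodory slope of its numerator at 0, which is continuous there, and functions of r are
    composed with |r| where continuity on r >= 0 is meant. *)

Lemma is_derive_lamC (R : realType) (c x : R) : is_derive x 1 (fun=> c) 0.
Proof. exact: is_derive_cst. Qed.

Lemma is_derive_lamD (R : realType) (f g : R -> R) (x df dg d : R) :
  is_derive x 1 f df -> is_derive x 1 g dg -> d = df + dg ->
  is_derive x 1 (fun y => f y + g y) d.
Proof. by move=> hf hg ->; exact: is_deriveD. Qed.

Lemma is_derive_lamB (R : realType) (f g : R -> R) (x df dg d : R) :
  is_derive x 1 f df -> is_derive x 1 g dg -> d = df - dg ->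
  is_derive x 1 (fun y => f y - g y) d.
Proof. by move=> hf hg ->; exact: is_deriveB. Qed.

Lemma is_derive_lamN (R : realType) (f : R -> R) (x df d : R) :
  is_derive x 1 f df -> d = - df -> is_derive x 1 (fun y => - f y) d.
Proof. by move=> hf ->; exact: is_deriveN. Qed.

Lemma is_derive_lamM (R : realType) (f g : R -> R) (x df dg d : R) :
  is_derive x 1 f df -> is_derive x 1 g dg -> d = df * g x + f x * dg ->
  is_derive x 1 (fun y => f y * g y) d.
Proof.
move=> hf hg ->; apply: (is_derive_eq (is_deriveM hf hg)).
by rewrite /GRing.scale /=; ring.
Qed.

Lemma is_derive_lamZ (R : realType) (c : R) (f : R -> R) (x df d : R) :
  is_derive x 1 f df -> d = c * df -> is_derive x 1 (fun y => c * f y) d.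
Proof.
move=> hf ->; apply: (is_derive_lamM (is_derive_lamC c x) hf).
by rewrite mul0r add0r.
Qed.

Lemma is_derive_lamV (R : realType) (f : R -> R) (x df d : R) :
  is_derive x 1 f df -> f x != 0 -> d = - df / f x ^+ 2 ->
  is_derive x 1 (fun y => (f y)^-1) d.
Proof.
move=> hf fx ->; apply: (is_derive_eq (@is_deriveV R f x df 1 fx hf)).
by rewrite /GRing.scale /= mulNr mulrC mulNr.
Qed.

Lemma is_derive_lamX (R : realType) (f : R -> R) (n : nat) (x df d : R) :
  is_derive x 1 f df -> d = n%:R * f x ^+ n.-1 * df ->
  is_derive x 1 (fun y => f y ^+ n) d.
Proof.
move=> hf ->; elim: n => [|n IH].
  by rewrite !mul0r; exact: is_derive_lamC.
have -> : (fun y => f y ^+ n.+1) = (fun y => f y * f y ^+ n).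
  by apply/funext => y; rewrite exprS.
apply: (is_derive_lamM hf IH) => /=.
case: n {IH} => [|n] /=; first by rewrite !expr0 !mul0r mulr0 addr0 !mul1r mulr1.
rewrite exprS -!natr1; ring.
Qed.

Lemma is_derive_lam_id (R : realType) (x : R) : is_derive x 1 (fun y : R => y) 1.
Proof. exact: is_derive_id. Qed.

Lemma is_derive_lam_comp (R : realType) (f g : R -> R) (x df dg d : R) :
  is_derive x 1 g dg -> is_derive (g x) 1 f df -> d = df * dg ->
  is_derive x 1 (fun y => f (g y)) d.
Proof. by move=> hg hf ->; exact: is_derive1_comp. Qed.

Lemma is_derive_continuous (R : realType) (f : R -> R) (x d : R) :
  is_derive x 1 f d -> {for x, continuous f}.
Proof.
by move=> [h _]; apply: differentiable_continuous; apply/derivable1_diffP.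
Qed.

Lemma nbhs_dist (R : realType) (x : R) (P : R -> Prop) :
  (exists2 e : R, 0 < e & forall y, `|y - x| < e -> P y) <-> \near x, P x.
Proof.
split=> [[e e0 h]|/nbhs_ballP[e /= e0 h]].
  by apply/nbhs_ballP; exists e => //= y; rewrite /ball /= distrC; exact: h.
by exists e => // y hy; apply: h; rewrite /ball /= distrC.
Qed.

Lemma continuous_dist (R : realType) (f : R -> R) (x : R) :
  {for x, continuous f} <->
  forall e, 0 < e -> exists2 d : R, 0 < d & forall y, `|y - x| < d -> `|f y - f x| < e.
Proof.
split=> [/cvgrPdist_lt h e e0|h].
  by move: (h e e0) => /nbhs_dist[d d0 hd]; exists d => // y /hd; rewrite distrC.
apply/cvgrPdist_lt => e e0; apply/nbhs_dist.
by have [d d0 hd] := h e e0; exists d => // y /hd; rewrite distrC.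
Qed.

Lemma is_derive_near (R : realType) (f g : R -> R) (x d : R) :
  (exists2 e : R, 0 < e & forall y, `|y - x| < e -> f y = g y) ->
  is_derive x 1 f d -> is_derive x 1 g d.
Proof. by move=> /nbhs_dist h; exact: near_eq_is_derive. Qed.

Lemma mean_value (R : realType) (f df : R -> R) (a b : R) :
  a < b -> (forall x, a < x < b -> is_derive x 1 f (df x)) ->
  {within `[a, b], continuous f} ->
  exists2 c, a < c < b & f b - f a = df c * (b - a).
Proof.
move=> ab h cf.
have h' x : x \in `]a, b[ -> is_derive x 1 f (df x).
  by rewrite in_itv /=; exact: h.
have [c cab e] := MVT ab h' cf.
by exists c => //; move: cab; rewrite in_itv.
Qed.

Lemma continuous_segment (R : realType) (f : R -> R) (a b : R) :
  (forall x, a <= x <= b -> {for x, continuous f}) ->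
  {within `[a, b], continuous f}.
Proof.
move=> h; apply: continuous_in_subspaceT => x.
by rewrite inE /= in_itv /=; exact: h.
Qed.

Lemma derive_ge0_le (R : realType) (f df : R -> R) (a b : R) :
  a <= b -> (forall x, a < x < b -> is_derive x 1 f (df x)) ->
  (forall x, a < x < b -> 0 <= df x) ->
  {within `[a, b], continuous f} -> f a <= f b.
Proof.
rewrite le_eqVlt => /orP[/eqP-> //|ab] h h0 cf.
have [c cab e] := mean_value ab h cf.
by rewrite -subr_ge0 e mulr_ge0 ?h0// subr_ge0 ltW.
Qed.

Lemma derive_le0_ge (R : realType) (f df : R -> R) (a b : R) :
  a <= b -> (forall x, a < x < b -> is_derive x 1 f (df x)) ->
  (forall x, a < x < b -> df x <= 0) ->
  {within `[a, b], continuous f} -> f b <= f a.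
Proof.
rewrite le_eqVlt => /orP[/eqP-> //|ab] h h0 cf.
have [c cab e] := mean_value ab h cf.
by rewrite -subr_le0 e mulr_le0_ge0 ?h0// subr_ge0 ltW.
Qed.

Lemma derive_gt0_lt (R : realType) (f df : R -> R) (a b : R) :
  a < b -> (forall x, a < x < b -> is_derive x 1 f (df x)) ->
  (forall x, a < x < b -> 0 < df x) ->
  {within `[a, b], continuous f} -> f a < f b.
Proof.
move=> ab h h0 cf.
have [c cab e] := mean_value ab h cf.
by rewrite -subr_gt0 e mulr_gt0 ?h0// subr_gt0.
Qed.

Lemma derive_lt0_gt (R : realType) (f df : R -> R) (a b : R) :
  a < b -> (forall x, a < x < b -> is_derive x 1 f (df x)) ->
  (forall x, a < x < b -> df x < 0) ->
  {within `[a, b], continuous f} -> f b < f a.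
Proof.
move=> ab h h0 cf.
have [c cab e] := mean_value ab h cf.
by rewrite -subr_lt0 e pmulr_llt0 ?h0// subr_gt0.
Qed.

Lemma intermediate_value (R : realType) (f : R -> R) (a b v : R) :
  a <= b -> (forall x, a <= x <= b -> {for x, continuous f}) ->
  (f a <= v <= f b) || (f b <= v <= f a) -> exists2 c, a <= c <= b & f c = v.
Proof.
move=> ab /continuous_segment cf hv.
have [|c] := @IVT R f a b v ab cf.
  by rewrite ge_min le_max; case/orP: hv => /andP[-> ->]; rewrite ?orbT.
by rewrite in_itv /= => hc e; exists c.
Qed.

Lemma segment_max (R : realType) (f : R -> R) (a b : R) :
  a <= b -> (forall x, a <= x <= b -> {for x, continuous f}) ->
  exists2 c, a <= c <= b & forall x, a <= x <= b -> f x <= f c.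
Proof.
move=> ab /continuous_segment cf.
have [c hc h] := EVT_max ab cf.
exists c; first by move: hc; rewrite in_itv.
by move=> x hx; apply: h; rewrite in_itv.
Qed.

Lemma segment_bounded (R : realType) (f : R -> R) (a b : R) :
  a <= b -> (forall x, a <= x <= b -> {for x, continuous f}) ->
  exists2 M, 0 <= M & forall x, a <= x <= b -> `|f x| <= M.
Proof.
move=> ab cf.
have [|c hc h] := @segment_max R (fun x => `|f x|) a b ab.
  by move=> x /cf hx; apply: (continuous_comp hx); exact: norm_continuous.
by exists `|f c|.
Qed.

Lemma interior_max_derive0 (R : realType) (f : R -> R) (x d e : R) :
  0 < e -> is_derive x 1 f d ->
  (forall y, `|y - x| < e -> is_derive y 1 f ('D_1 f y)) ->
  (forall y, `|y - x| < e -> f y <= f x) -> d = 0.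
Proof.
move=> e0 hd h hm.
have hI y : y \in `]x - e, x + e[ -> `|y - x| < e.
  by rewrite in_itv /= ltr_distl.
have /(@derive_val _ _ _ _ _ _ _) <- : is_derive x 1 f 0.
  apply: (@derive1_at_max R f (x - e) (x + e) x).
  - lra.
  - by move=> y /hI /h [].
  - rewrite in_itv /=; lra.
  - by move=> y /hI /hm.
by rewrite derive_val.
Qed.

(** At the minimum [df x = 0]. If d < 0, the Caratheodory slope of [df] stays negative near x, so
    [df] is negative just to the right of x and f drops below its minimum. The second derivative is
    used at x only. *)
Lemma second_derivative_min (R : realType) (f df : R -> R) (x d e : R) :
  0 < e -> (forall y, `|y - x| < e -> is_derive y 1 f (df y)) ->
  (forall y, `|y - x| < e -> f x <= f y) ->
  is_derive x 1 df d -> 0 <= d.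
Proof.
move=> e0 hf hm hd; rewrite leNgt; apply/negP => d0.
have xx : `|x - x| < e by rewrite subrr normr0.
have dfx : df x = 0.
  apply/eqP; rewrite -oppr_eq0; apply/eqP.
  apply: (@interior_max_derive0 R (fun y => - f y) x _ e e0).
  - by apply: is_derive_lamN; first exact: hf.
  - move=> y /hf hy; apply: derivableP.
    by have := is_derive_lamN hy erefl; case.
  - by move=> y /hm; rewrite lerN2.
have /is_derive1_caratheodory[g [hg cg gx]] := hd.
have /continuous_dist /(_ (- d)) := cg; rewrite oppr_gt0 => /(_ d0)[k k0 hk].
pose b := x + Num.min e k / 2.
have mk : 0 < Num.min e k by rewrite lt_min e0.
have [h1 h2] : Num.min e k <= e /\ Num.min e k <= k.
  by rewrite !ge_min !lexx orbT.
have hb z : x <= z <= b -> `|z - x| < e /\ `|z - x| < k.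
  by move=> /andP[zx zb]; rewrite ger0_norm ?subr_ge0//; split; move: zb; rewrite /b; lra.
have xb : x < b by rewrite /b; lra.
have : f b < f x.
  apply: (@derive_lt0_gt R f df x b xb).
  - by move=> z /andP[z1 z2]; apply: hf; case: (hb z) => //; lra.
  - move=> z /andP[z1 z2]; have := hg z; rewrite dfx subr0 => ->.
    rewrite pmulr_llt0 ?subr_gt0//.
    have [|_ /hk] := hb z; first lra.
    rewrite gx ltr_distl; lra.
  - apply: continuous_segment => z /hb[hz _].
    exact: is_derive_continuous (hf z hz).
by apply/negP; rewrite -leNgt; apply: hm; case: (hb b) => //; lra.
Qed.

Lemma antiderivative (R : realType) (f : R -> R) :
  continuous f ->
  exists2 F : R -> R, F 0 = 0 & forall x : R, 0 <= x -> is_derive x 1 F (f x).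
Proof.
move=> cf.
(* Integrating from -1 makes 0 an interior point, so that the derivative at 0 is two-sided. *)
pose F := fun x : R =>
  (\int[lebesgue_measure]_(t in [set` `[(-1 : R), x]]) f t)%R.
exists (fun x => F x - F 0); first by rewrite subrr.
move=> x x0.
suff hF : is_derive x 1 F (f x).
  by apply: (is_derive_lamB hF (is_derive_lamC (F 0) x)); rewrite subr0.
have [] := @continuous_FTC1_closed R f (-1) x (x + 1) _ _ _ (cf x).
- lra.
- apply: continuous_compact_integrable; first exact: segment_compact.
  exact: continuous_subspaceT.
- lra.
by move=> h1 <-; rewrite derive1E; exact: derivableP.
Qed.

(** * Bounds by Dirichlet eigenvalues *)

Lemma enorm_ge0 (R : realType) (N : nat) (x : 'rV[R]_N) : 0 <= enorm x.
Proof. exact: sqrtr_ge0. Qed.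

Lemma sqr_enorm (R : realType) (N : nat) (x : 'rV[R]_N) :
  enorm x ^+ 2 = \sum_(i < N) x ord0 i ^+ 2.
Proof. by rewrite sqr_sqrtr// sumr_ge0// => i _; rewrite sqr_ge0. Qed.

Lemma coord_le_enorm (R : realType) (N : nat) (x : 'rV[R]_N) (i : 'I_N) :
  `|x ord0 i| <= enorm x.
Proof.
rewrite -sqrtr_sqr ler_sqrt ?sumr_ge0// => [|j _]; last by rewrite sqr_ge0.
by rewrite (bigD1 i)//= lerDl sumr_ge0// => j _; rewrite sqr_ge0.
Qed.

Lemma enorm_continuous (R : realType) (N : nat) :
  continuous (@enorm R N).
Proof.
move=> x; apply: (@continuous_comp _ _ _ (fun x : 'rV[R]_N => \sum_(i < N) x ord0 i ^+ 2)).
  have -> : (fun x : 'rV[R]_N => \sum_(i < N) x ord0 i ^+ 2) =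
    \sum_(i < N) (fun x : 'rV[R]_N => x ord0 i ^+ 2).
    by apply/funext => y; rewrite fct_sumE.
  elim/big_ind: _ => [|f g cf cg|i _].
  - exact: cst_continuous.
  - exact: continuousD.
  - apply: (@continuous_comp _ _ _ (fun x : 'rV[R]_N => x ord0 i) (fun y : R => y ^+ 2)).
      exact: coord_continuous.
    exact: exprn_continuous.
exact: sqrt_continuous.
Qed.

Lemma closed_unit_ball_compact (R : realType) (N : nat) :
  compact (@closed_unit_ball R N).
Proof.
apply: bounded_closed_compact.
  exists 1; split => // M M1 x xB.
  rewrite /= /Num.norm /= mx_normrE; apply/bigmax_leP; split => [|[i j] _ /=].
    exact: le_trans ler01 (ltW M1).
  rewrite (ord1 i); apply: le_trans (coord_le_enorm _ _) _.
  exact: le_trans xB (ltW M1).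
have -> : @closed_unit_ball R N = (@enorm R N) @^-1` [set y | y <= 1] by [].
apply: preimage_closed; last exact: closed_le.
by move=> x _; exact: enorm_continuous.
Qed.

Lemma unit_ballW (R : realType) (N : nat) (x : 'rV[R]_N) :
  unit_ball x -> closed_unit_ball x.
Proof. exact: ltW. Qed.

Lemma unit_ball_near (R : realType) (N : nat) (x : 'rV[R]_N) :
  unit_ball x -> \near x, unit_ball x.
Proof.
move=> xB; apply: (@enorm_continuous R N x [set y | y < 1]).
exact: lt_nbhsl.
Qed.

Lemma line_continuous (R : realType) (N : nat) (x v : 'rV[R]_N) :
  continuous (fun s : R => x + s *: v).
Proof.
move=> s; apply: (@continuousD _ _ _ (fun=> x) (fun s : R => s *: v)).
  exact: cst_continuous.
exact: scalel_continuous.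
Qed.

Lemma unit_ball_line (R : realType) (N : nat) (x v : 'rV[R]_N) :
  unit_ball x ->
  exists2 e : R, 0 < e & forall s, `|s| < e -> unit_ball (x + s *: v).
Proof.
move=> xB.
have /nbhs_dist[e e0 h] : \forall s \near (0 : R), unit_ball (x + s *: v).
  apply: (@line_continuous R N x v 0 [set y | unit_ball y]).
  by rewrite /= scale0r addr0; exact: unit_ball_near.
by exists e => // s se; apply: h; rewrite subr0.
Qed.

(** The two difference quotients are the same function of h; this moves every directional derivative
    into one variable. *)
Lemma is_derive_line (R : realType) (N : nat) (U : 'rV[R]_N -> R)
    (x v : 'rV[R]_N) (s d : R) :
  is_derive (x + s *: v) v U d <-> is_derive s 1 (fun s => U (x + s *: v)) d.
Proof.
have E : (fun h : R => h^-1 *: ((U \o shift (x + s *: v)) (h *: v) - U (x + s *: v))) =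
  (fun h : R => h^-1 *: (((fun s => U (x + s *: v)) \o shift s) (h *: (1 : R)) - U (x + s *: v))).
  apply/funext => h /=; congr (_ *: (U _ - _)).
  by rewrite scalerDl addrCA addrA /GRing.scale /= mulr1 -addrA addrC -addrA.
split=> -[h1 h2]; split.
- by rewrite /derivable -E.
- by rewrite /derive -E.
- by rewrite /derivable E.
- by rewrite /derive E.
Qed.

Lemma closed_unit_ball_max (R : realType) (N : nat) (f : 'rV[R]_N -> R)
    (p : 'rV[R]_N) :
  closed_unit_ball p -> {within @closed_unit_ball R N, continuous f} ->
  exists2 c, closed_unit_ball c & forall x, closed_unit_ball x -> f x <= f c.
Proof.
move=> pB cf.
have B0 : @closed_unit_ball R N !=set0 by exists p.
have [c cB h] := EVT_max_rV B0 (@closed_unit_ball_compact R N) cf.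
exists c; first by move: cB; rewrite inE.
by move=> x xB; apply: h; rewrite inE.
Qed.

(* Barta's inequality: at an interior maximum point of phi / V, the second
   derivatives of t V - phi are nonnegative, where t is the maximum. *)
Lemma barta (R : realType) (N : nat) (nu mu : R) (V : 'rV[R]_N -> R)
    (V1 V2 : 'I_N -> 'rV[R]_N -> R) :
  {within @closed_unit_ball R N, continuous V} ->
  (forall x, closed_unit_ball x -> 0 < V x) ->
  (forall i x, unit_ball x -> is_derive x (delta_mx ord0 i) V (V1 i x)) ->
  (forall i x, unit_ball x -> is_derive x (delta_mx ord0 i) (V1 i) (V2 i x)) ->
  (forall x, unit_ball x -> \sum_(i < N) V2 i x < - nu * V x) ->
  dirichlet_eigenvalue N mu -> nu < mu.
Proof.
move=> cV V0 dV dV1 superV [phi [[[C1 C2] cphi phi0] [p [pB phip]] eig]].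
(* The eigenfunction may change sign; this c makes f positive at p, so the maximum t is positive and
   cannot lie on the sphere, where phi vanishes. *)
pose c := Num.sg (phi p); pose f x := c * phi x / V x.
have cf : {within @closed_unit_ball R N, continuous f}.
  rewrite continuous_subspace_in => x; rewrite inE => xB.
  apply: cvgM; last first.
    by apply: cvgV; [rewrite gt_eqF// V0|exact: cV].
  by apply: cvgM; [exact: cvg_cst|exact: cphi].
have [x0 x0B maxf] := closed_unit_ball_max (unit_ballW pB) cf.
set t := f x0 in maxf.
have t0 : 0 < t.
  apply: lt_le_trans (maxf _ (unit_ballW pB)).
  rewrite /f divr_gt0 ?V0//; last exact: unit_ballW.
  by rewrite /c -normrEsg normr_gt0; apply/eqP.
have x0I : unit_ball x0.
  rewrite /unit_ball /= lt_neqAle x0B andbT; apply/eqP => x0S.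
  by move: t0; rewrite /t /f phi0// mulr0 mul0r ltxx.
have ft x : closed_unit_ball x -> 0 <= t * V x - c * phi x.
  by move=> xB; rewrite subr_ge0 -ler_pdivrMr ?V0//; exact: maxf.
have ft0 : t * V x0 - c * phi x0 = 0.
  by rewrite /t /f divfK ?subrr// gt_eqF// V0.
have key i : 0 <= t * V2 i x0 - c * partial i (partial i phi) x0.
  have [e e0 eB] := unit_ball_line (delta_mx ord0 i) x0I.
  pose L s := x0 + s *: delta_mx ord0 i.
  apply: (@second_derivative_min R (fun s => t * V (L s) - c * phi (L s))
    (fun s => t * V1 i (L s) - c * partial i phi (L s)) 0 _ e e0).
  - move=> s; rewrite subr0 => /eB sB.
    have h1 := (is_derive_line _ _ _ _ _).1 (dV i _ sB).
    have [/derivableP h2 _] := C1 i _ sB.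
    have {}h2 := (is_derive_line _ _ _ _ _).1 h2.
    exact: (is_derive_lamB (is_derive_lamZ h1 erefl) (is_derive_lamZ h2 erefl)).
  - move=> s; rewrite subr0 /L scale0r addr0 ft0 => /eB sB.
    by apply: ft; exact: unit_ballW.
  - have L0 : L 0 = x0 by rewrite /L scale0r addr0.
    have xB : unit_ball (L 0) by rewrite L0.
    have h1 := (is_derive_line _ _ _ _ _).1 (dV1 i _ xB).
    have [/derivableP h2 _] := C2 i i _ xB.
    have {}h2 := (is_derive_line _ _ _ _ _).1 h2.
    rewrite -[in X in is_derive _ _ _ X]L0.
    exact: (is_derive_lamB (is_derive_lamZ h1 erefl) (is_derive_lamZ h2 erefl)).
(* Since c phi = t V at x0, the sum over i reads 0 <= t (laplacian V + mu V), which contradicts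
   [superV] unless nu < mu. *)
have : 0 <= t * (\sum_(i < N) V2 i x0) - c * laplacian phi x0.
  by rewrite /laplacian !mulr_sumr -sumrB sumr_ge0.
have -> : laplacian phi x0 = - (mu * phi x0) by rewrite -eig// opprK.
have -> : c * - (mu * phi x0) = - (mu * (t * V x0)).
  by rewrite mulrN mulrCA; move/eqP: ft0; rewrite subr_eq0 => /eqP ->.
have := superV _ x0I; have := V0 _ (unit_ballW x0I) => vx0 sv h.
have {}h : 0 <= \sum_(i < N) V2 i x0 + mu * V x0.
  rewrite -(pmulr_rge0 _ t0); move: h; rewrite opprK.
  by congr (0 <= _); ring.
rewrite -subr_gt0 -(pmulr_lgt0 _ vx0) mulrBl; lra.
Qed.

(** Barta's inequality with nu = 0 and the strictly superharmonic barrier 2 - |x|^2, positive up to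
    the sphere. *)
Lemma dirichlet_eigenvalue_gt0 (R : realType) (N : nat) (mu : R) :
  (0 < N)%N -> dirichlet_eigenvalue N mu -> 0 < mu.
Proof.
move=> N0.
apply: (@barta R N 0 mu (fun x => 2 - \sum_(i < N) x ord0 i ^+ 2)
  (fun i x => - (2 * x ord0 i)) (fun _ _ => - 2)).
- apply: continuous_subspaceT => x.
  have -> : (fun x : 'rV[R]_N => 2 - \sum_(i < N) x ord0 i ^+ 2) =
    (fun x => 2 - enorm x ^+ 2) by apply/funext => y; rewrite sqr_enorm.
  apply: (@continuous_comp _ _ _ (@enorm R N) (fun y : R => 2 - y ^+ 2)).
    exact: enorm_continuous.
  have h := is_derive_lamX (n := 2%N) (is_derive_lam_id (enorm x)) erefl.
  exact: is_derive_continuous (is_derive_lamB (is_derive_lamC 2 (enorm x)) h erefl).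
- move=> x xB; rewrite -sqr_enorm subr_gt0.
  by apply: le_lt_trans (_ : 1 < _); [rewrite expr_le1 ?enorm_ge0|lra].
- move=> i x _.
  have -> : x = x + 0 *: delta_mx ord0 i by rewrite scale0r addr0.
  apply/is_derive_line.
  have -> : (fun s : R => 2 - \sum_(j < N) (x + s *: delta_mx ord0 i) ord0 j ^+ 2) =
    (fun s => 2 - \sum_(j < N | j != i) x ord0 j ^+ 2 - (x ord0 i + s) ^+ 2).
    apply/funext => s; rewrite (bigD1 i)//= !mxE !eqxx mulr1 opprD addrA addrAC.
    congr (_ - _ - _); apply: eq_bigr => j ji.
    by rewrite !mxE (negbTE ji) andbF mulr0 addr0.
  have h := is_derive_lamD (is_derive_lamC (x ord0 i) 0) (is_derive_lam_id (0 : R)) erefl.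
  apply: (is_derive_lamB (is_derive_lamC _ _) (is_derive_lamX (n := 2%N) h erefl)).
  rewrite !mxE /=; ring.
- move=> i x _.
  have -> : x = x + 0 *: delta_mx ord0 i by rewrite scale0r addr0.
  apply/is_derive_line.
  have -> : (fun s : R => - (2 * (x + s *: delta_mx ord0 i) ord0 i)) =
    (fun s => - (2 * (x ord0 i + s))).
    by apply/funext => s; rewrite !mxE !eqxx mulr1.
  have h := is_derive_lamD (is_derive_lamC (x ord0 i) 0) (is_derive_lam_id (0 : R)) erefl.
  apply: (is_derive_lamN (is_derive_lamZ h erefl)); ring.
- move=> x _; rewrite oppr0 mul0r sumr_const card_ord mulNrn oppr_lt0.
  by rewrite pmulrn_lgt0.
Qed.

(* With V = (exp (delta U) - 1) / delta + k the gradient terms have the right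
   sign, since V'' <= delta V' / (1 - U). *)
Lemma eigenvalue_bound (R : realType) (N : nat) (lambda delta k nu mu : R)
    (U : 'rV[R]_N -> R) :
  0 < lambda -> 0 < delta -> 0 < k ->
  (forall u, 0 < u < 1 ->
     nu * ((expR (delta * u) - 1) / delta + k) < lambda * expR (delta * u) / (1 - u)) ->
  regular_solution lambda delta U -> dirichlet_eigenvalue N mu -> nu < mu.
Proof.
move=> l0 d0 k0 hk [[[C1 C2] cU U0] U01 eqU].
have Uge0 x : closed_unit_ball x -> 0 <= U x.
  move=> xB; have [/U01/andP[/ltW]//|xI] := pselect (unit_ball x).
  rewrite U0//; apply/eqP; rewrite eq_le xB /= leNgt; exact/negP.
pose E x := expR (delta * U x).
apply: (@barta R N nu mu (fun x => (E x - 1) / delta + k)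
  (fun i x => E x * partial i U x)
  (fun i x => E x * (delta * partial i U x ^+ 2 + partial i (partial i U) x))).
- have -> : (fun x => (E x - 1) / delta + k) =
    (fun u => (expR (delta * u) - 1) / delta + k) \o U by [].
  apply: within_continuous_comp => //.
  move=> u _; apply: (@is_derive_continuous _ _ _ (expR (delta * u))).
  have h := is_derive_lam_comp
    (is_derive_lamZ (c := delta) (is_derive_lam_id u) erefl)
    (is_derive_expR (delta * u)) erefl.
  have {}h := is_derive_lamB h (is_derive_lamC 1 u) erefl.
  have {}h := is_derive_lamM h (is_derive_lamC delta^-1 u) erefl.
  apply: (is_derive_lamD h (is_derive_lamC k u)).
  by field; rewrite gt_eqF.
- move=> x xB; rewrite ltr_wpDl// divr_ge0 ?(ltW d0)// subr_ge0.
  by rewrite -expR0 ler_expR mulr_ge0 ?(ltW d0)// Uge0.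
- move=> i x xB; have [/derivableP h _] := C1 i _ xB.
  move: h; have -> : x = x + 0 *: delta_mx ord0 i by rewrite scale0r addr0.
  move=> /is_derive_line h; apply/is_derive_line; rewrite /E.
  have h2 := is_derive_lam_comp (is_derive_lamZ (c := delta) h erefl) (is_derive_expR _) erefl.
  have {}h2 := is_derive_lamB h2 (is_derive_lamC 1 0) erefl.
  have {}h2 := is_derive_lamM h2 (is_derive_lamC delta^-1 0) erefl.
  apply: (is_derive_lamD h2 (is_derive_lamC k 0)).
  by rewrite /partial; field; rewrite gt_eqF.
- move=> i x xB; have [/derivableP h _] := C1 i _ xB.
  have [/derivableP h' _] := C2 i i _ xB.
  move: h h'; have -> : x = x + 0 *: delta_mx ord0 i by rewrite scale0r addr0.
  move=> /is_derive_line h /is_derive_line h'; apply/is_derive_line; rewrite /E.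
  have h2 := is_derive_lam_comp (is_derive_lamZ (c := delta) h erefl) (is_derive_expR _) erefl.
  apply: (is_derive_lamM h2 h').
  by rewrite /partial; ring.
- move=> x xB; have /andP[u0 u1] := U01 _ xB.
  have E0 : 0 < E x by exact: expR_gt0.
  rewrite -mulr_sumr big_split /= -mulr_sumr -/(laplacian U x).
  have -> : \sum_(i < N) partial i U x ^+ 2 = enorm (gradient U x) ^+ 2.
    by rewrite sqr_enorm; apply: eq_bigr => i _; rewrite mxE.
  set G := _ ^+ 2; have G0 : 0 <= G by exact: sqr_ge0.
  have -> : laplacian U x = - ((lambda + delta * G) / (1 - U x)).
    by rewrite -eqU// opprK.
  rewrite mulNr ltrNr; apply: lt_le_trans (hk (U x) _) _; first by rewrite u0.
  rewrite -/(E x) -subr_ge0.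
  (* The surplus over the lower bound is the gradient term times 1 / (1 - U) - 1, which is
     nonnegative. *)
  have -> : - (E x * (delta * G - (lambda + delta * G) / (1 - U x))) -
    lambda * E x / (1 - U x) = E x * (delta * G) * ((1 - U x)^-1 - 1) by ring.
  apply: mulr_ge0; first by apply: mulr_ge0; [exact: ltW|exact: mulr_ge0 (ltW _) _].
  by rewrite subr_ge0 ltW// invf_gt1 ?subr_gt0//; lra.
Qed.

(** For k = 1 / delta the barrier is exp (delta U) / delta, and the required inequality reduces to 1
    < 1 / (1 - u). *)
Lemma lambda_lt_mu_div_delta (R : realType) (N : nat) (lambda delta mu : R)
    (U : 'rV[R]_N -> R) :
  0 < lambda -> 0 < delta -> regular_solution lambda delta U ->
  dirichlet_eigenvalue N mu -> lambda < mu / delta.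
Proof.
move=> l0 d0 hU hmu; rewrite ltr_pdivlMr//.
have k0 : 0 < delta^-1 by rewrite invr_gt0.
apply: (eigenvalue_bound l0 d0 k0 _ hU hmu) => u /andP[u0 u1].
have -> : lambda * delta * ((expR (delta * u) - 1) / delta + delta^-1) =
  lambda * expR (delta * u) by field; rewrite gt_eqF.
rewrite ltr_pMr ?mulr_gt0 ?expR_gt0// invf_gt1 ?subr_gt0//; lra.
Qed.

(** For 0 < u < 1, exp x - 1 < x exp x at x = delta u bounds the subtracted term by 4 u (1 - u) exp
    (delta u), and 4 u (1 - u) <= 1. The endpoints are included so that compactness yields a uniform
    gap. *)
Lemma expR_barrier_gt0 (R : realType) (delta u : R) : 0 < delta -> 0 <= u <= 1 ->
  0 < expR (delta * u) - 4 * (1 - u) * ((expR (delta * u) - 1) / delta).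
Proof.
move=> d0 /andP[]; rewrite le_eqVlt => /orP[/eqP<- _|u0].
  by rewrite mulr0 expR0; lra.
have E0 := expR_gt0 (delta * u); rewrite le_eqVlt => /orP[/eqP->|u1].
  by rewrite subrr mulr0 mul0r subr0 expR_gt0.
have x0 : 0 < delta * u by exact: mulr_gt0.
have h : (expR (delta * u) - 1) / delta < u * expR (delta * u).
  rewrite ltr_pdivrMr//; have := @expR_gt1Dx R (- (delta * u)).
  rewrite oppr_eq0 gt_eqF// => /(_ isT).
  by rewrite expRN -(ltr_pM2r E0) mulVf ?gt_eqF//; lra.
have h' : 4 * (1 - u) * ((expR (delta * u) - 1) / delta) <
    4 * (1 - u) * (u * expR (delta * u)) by rewrite ltr_pM2l//; lra.
have : 0 <= (1 - 2 * u) ^+ 2 * expR (delta * u) by rewrite mulr_ge0 ?sqr_ge0// ltW.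
nra.
Qed.

Lemma lambda_lt_mu_div4 (R : realType) (N : nat) (lambda delta mu : R)
    (U : 'rV[R]_N -> R) :
  0 < lambda -> 0 < delta -> regular_solution lambda delta U ->
  dirichlet_eigenvalue N mu -> lambda < mu / 4.
Proof.
move=> l0 d0 hU hmu; rewrite ltr_pdivlMr//.
pose h u : R := 4 * (1 - u) * ((expR (delta * u) - 1) / delta) - expR (delta * u).
have [|c c01 hc] := @segment_max R h 0 1 ler01.
  move=> u _.
  have dE := is_derive_lam_comp
    (is_derive_lamZ (c := delta) (is_derive_lam_id u) erefl)
    (is_derive_expR (delta * u)) erefl.
  have d1 := is_derive_lamM (is_derive_lamB dE (is_derive_lamC 1 u) erefl)
    (is_derive_lamC delta^-1 u) erefl.
  have d2 := is_derive_lamZ (c := 4)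
    (is_derive_lamB (is_derive_lamC 1 u) (is_derive_lam_id u) erefl) erefl.
  exact: is_derive_continuous (is_derive_lamB (is_derive_lamM d2 d1 erefl) dE erefl).
have hc0 : 0 < - h c by rewrite opprB; exact: expR_barrier_gt0.
(* The gap [- h c] is the minimum of - h on [0, 1]; with k one eighth of it, the term 4 k (1 - u)
   costs at most half of the gap. *)
have k0 : 0 < - h c / 8 by rewrite divr_gt0.
apply: (eigenvalue_bound l0 d0 k0 _ hU hmu) => u /andP[u0 u1].
rewrite ltr_pdivlMr ?subr_gt0// -subr_gt0.
have hu : h u <= h c by apply: hc; rewrite !ltW.
have -> : lambda * expR (delta * u) - lambda * 4 *
    ((expR (delta * u) - 1) / delta + - h c / 8) * (1 - u) =
  lambda * (- h u - (- h c) / 2 * (1 - u)) by rewrite {2}/h; field; rewrite gt_eqF.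
apply: mulr_gt0 => //; nra.
Qed.

(** * Radial functions *)

(* [q] is [u' / r], extended by continuity to [r = 0]. *)
Definition radial_C2_data (R : realType) (u p s q : R -> R) : Prop :=
  [/\ forall r : R, 0 <= r < 1 -> is_derive r 1 u (p r),
      forall r : R, 0 <= r < 1 -> is_derive r 1 p (s r),
      forall r : R, 0 <= r < 1 -> {for r, continuous (fun t => s `|t|)},
      forall r, p r = q r * r
    & {for 0, continuous q} /\ q 0 = s 0].

Lemma continuous_lamB (R : realType) (T : topologicalType) (f g : T -> R) (x : T) :
  {for x, continuous f} -> {for x, continuous g} ->
  {for x, continuous (fun y => f y - g y)}.
Proof. by move=> cf cg; exact: (@cvgB _ _ _ _ _ f g _ _ cf cg). Qed.

Lemma continuous_lamD (R : realType) (T : topologicalType) (f g : T -> R) (x : T) :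
  {for x, continuous f} -> {for x, continuous g} ->
  {for x, continuous (fun y => f y + g y)}.
Proof. by move=> cf cg; exact: (@cvgD _ _ _ _ _ f g _ _ cf cg). Qed.

Lemma continuous_lamM (R : realType) (T : topologicalType) (f g : T -> R) (x : T) :
  {for x, continuous f} -> {for x, continuous g} ->
  {for x, continuous (fun y => f y * g y)}.
Proof. by move=> cf cg; exact: (@cvgM _ _ _ _ f g _ _ cf cg). Qed.

Lemma continuous_lamV (R : realType) (T : topologicalType) (f : T -> R) (x : T) :
  {for x, continuous f} -> f x != 0 -> {for x, continuous (fun y => (f y)^-1)}.
Proof. by move=> cf f0; exact: (@cvgV _ _ _ _ f _ f0 cf). Qed.

Lemma continuous_zero_dominated (R : realType) (T : topologicalType) (f g : T -> R) (x : T) :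
  {for x, continuous g} -> g x = 0 -> (forall y, `|f y| <= `|g y|) ->
  {for x, continuous f}.
Proof.
move=> /cvgrPdist_lt cg gx fg.
have fx : f x = 0 by apply/normr0_eq0/eqP; rewrite eq_le normr_ge0 -[leRHS](normr0 R) -gx fg.
apply/cvgrPdist_lt => e /cg; apply: filterS => y.
by rewrite gx fx !sub0r !normrN; exact: le_lt_trans.
Qed.

Lemma near_continuous (R : realType) (T : topologicalType) (f g : T -> R) (x : T) :
  (\near x, f x = g x) -> {for x, continuous g} -> {for x, continuous f}.
Proof.
move=> fg cg; rewrite /prop_for /continuous_at (nbhs_singleton fg).
apply: cvg_trans cg; apply: near_eq_cvg.
by apply: filterS fg => y ->.
Qed.

(** Composition with |t| expresses continuity on r >= 0; away from 0 it is ordinary continuity. *)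
Lemma continuous_abs_pos (R : realType) (f : R -> R) (r : R) :
  0 < r -> {for r, continuous f} <-> {for r, continuous (fun t => f `|t|)}.
Proof.
move=> r0.
have E : \forall t \near r, f `|t| = f t.
  by near=> t; rewrite gtr0_norm//; near: t; exact: lt_nbhsr.
by split; apply: near_continuous => //; near do apply/esym.
Unshelve. all: by end_near. Qed.

Lemma quotient_continuous (R : realType) (p q : R -> R) (r d : R) :
  (forall t, p t = q t * t) -> {for 0, continuous q} -> 0 <= r ->
  is_derive r 1 p d -> {for r, continuous (fun t => q `|t|)}.
Proof.
move=> pq cq; rewrite le_eqVlt => /orP[/eqP<- _|r0 dp].
  apply: (@continuous_comp _ _ _ (fun t : R => `|t|) q); first exact: norm_continuous.
  by rewrite normr0.
apply/(continuous_abs_pos q r0).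
have h := is_derive_lamM dp
  (is_derive_lamV (is_derive_lam_id r) (lt0r_neq0 r0) erefl) erefl.
apply: near_continuous (is_derive_continuous h).
by near=> t; rewrite pq mulfK// gt_eqF//; near: t; exact: lt_nbhsr.
Unshelve. all: by end_near. Qed.

Lemma radial_quotient_continuous (R : realType) (u p s q : R -> R) (r : R) :
  radial_C2_data u p s q -> 0 <= r < 1 -> {for r, continuous (fun t => q `|t|)}.
Proof.
move=> [_ hp _ pq [cq _]] hr; case/andP: (hr) => r0 _.
exact: quotient_continuous pq cq r0 (hp r hr).
Qed.

Lemma continuous_radial (R : realType) (N : nat) (f : R -> R) (x : 'rV[R]_N) :
  {for enorm x, continuous (fun t => f `|t|)} ->
  {for x, continuous (fun y => f (enorm y))}.
Proof.
move=> cf.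
have -> : (fun y : 'rV[R]_N => f (enorm y)) = (fun t => f `|t|) \o @enorm R N.
  by apply/funext => y /=; rewrite ger0_norm ?enorm_ge0.
by apply: continuous_comp => //; exact: enorm_continuous.
Qed.

Lemma enorm_eq0 (R : realType) (N : nat) (x : 'rV[R]_N) : (enorm x == 0) = (x == 0).
Proof.
apply/eqP/eqP => [h|->]; last first.
  by rewrite /enorm big1 ?sqrtr0// => i _; rewrite mxE expr0n.
apply/rowP => i; rewrite mxE; apply/normr0_eq0/eqP.
by rewrite eq_le normr_ge0 -h coord_le_enorm.
Qed.

Lemma is_derive_enorm_line (R : realType) (N : nat) (x : 'rV[R]_N) (i : 'I_N) :
  x != 0 ->
  is_derive (0 : R) 1 (fun t => enorm (x + t *: delta_mx ord0 i)) (x ord0 i / enorm x).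
Proof.
move=> x0; pose c := \sum_(j < N | j != i) x ord0 j ^+ 2.
have E t : enorm (x + t *: delta_mx ord0 i) = Num.sqrt (c + (x ord0 i + t) ^+ 2).
  rewrite /enorm (bigD1 i)//= !mxE !eqxx mulr1 addrC; congr (Num.sqrt (_ + _)).
  by apply: eq_bigr => j ji; rewrite !mxE (negbTE ji) andbF mulr0 addr0.
have E0 : enorm x = Num.sqrt (c + (x ord0 i + 0) ^+ 2).
  by rewrite -E scale0r addr0.
have r0 : 0 < enorm x by rewrite lt_neqAle enorm_ge0 eq_sym enorm_eq0 x0.
have h := is_derive_lamD (is_derive_lamC (x ord0 i) 0) (is_derive_lam_id (0 : R)) erefl.
have {}h := is_derive_lamD (is_derive_lamC c 0) (is_derive_lamX (n := 2%N) h erefl) erefl.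
rewrite (funext E).
have c0 : 0 < c + (x ord0 i + 0) ^+ 2 by rewrite -sqrtr_gt0 -E0.
apply: (is_derive_lam_comp h (is_derive1_sqrt c0)).
by rewrite -E0 /= addr0; field; rewrite gt_eqF.
Qed.

(** A zero slope removes the corner of |t|: the Caratheodory slope of the composite is g |z| times
    the sign of z, continuous at 0 because g 0 = 0. *)
Lemma is_derive_comp_abs0 (R : realType) (u : R -> R) :
  is_derive (0 : R) 1 u 0 -> is_derive (0 : R) 1 (fun t => u `|t|) 0.
Proof.
move=> /is_derive1_caratheodory[g [hg cg g0]].
apply/is_derive1_caratheodory; exists (fun z => g `|z| * Num.sg z); split.
- by move=> z; rewrite normr0 hg !subr0 -mulrA -normrEsg.
- apply/continuous_dist => e e0.
  have /continuous_dist /(_ e e0)[d d0 hd] := cg.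
  exists d => // y; rewrite subr0 => yd.
  rewrite normr0 g0 mul0r subr0 normrM.
  have /hd : `| `|y| - 0| < d by rewrite subr0 normr_id.
  rewrite g0 subr0; apply: le_lt_trans; rewrite ler_piMr// normr_sg.
  by case: eqP.
- by rewrite normr0 sgr0 mulr0.
Qed.

Lemma enorm_delta_line (R : realType) (N : nat) (i : 'I_N) (t : R) :
  enorm (t *: (delta_mx ord0 i : 'rV[R]_N)) = `|t|.
Proof.
rewrite /enorm (bigD1 i)//= big1 ?addr0 => [|j ji].
  by rewrite !mxE !eqxx mulr1 sqrtr_sqr.
by rewrite !mxE (negbTE ji) andbF mulr0 expr0n.
Qed.

(** With q = u' / r the formula contains no division and holds at the origin too, where the norm is
    not differentiable and p 0 = 0 is used instead. *)
Lemma radial_is_derive (R : realType) (N : nat) (u p s q : R -> R)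
    (U : 'rV[R]_N -> R) (x : 'rV[R]_N) (i : 'I_N) :
  radial_C2_data u p s q -> (forall y, unit_ball y -> U y = u (enorm y)) ->
  unit_ball x -> is_derive x (delta_mx ord0 i) U (x ord0 i * q (enorm x)).
Proof.
move=> [hu _ _ pq _] hU xB.
rewrite -[X in is_derive X](addr0 x) -[X in x + X](scale0r (delta_mx ord0 i)).
apply/is_derive_line.
have [e e0 eB] := unit_ball_line (delta_mx ord0 i) xB.
apply: (@is_derive_near _ (fun t => u (enorm (x + t *: delta_mx ord0 i)))).
  by exists e => // t; rewrite subr0 => /eB h; rewrite hU.
have [->|x0] := eqVneq x 0.
  have -> : (fun t : R => u (enorm ((0 : 'rV[R]_N) + t *: delta_mx ord0 i))) =
    (fun t => u `|t|) by apply/funext => t; rewrite add0r enorm_delta_line.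
  rewrite mxE mul0r; apply: is_derive_comp_abs0.
  by have := hu 0; rewrite pq mulr0; apply; rewrite lexx ltr01.
have r0 : 0 < enorm x by rewrite lt_neqAle enorm_ge0 eq_sym enorm_eq0 x0.
have h : is_derive (enorm (x + 0 *: delta_mx ord0 i)) 1 u (p (enorm x)).
  by rewrite scale0r addr0; apply: hu; rewrite enorm_ge0.
apply: (is_derive_lam_comp (is_derive_enorm_line i x0) h).
by rewrite pq; field; rewrite gt_eqF.
Qed.

Lemma radial_partial (R : realType) (N : nat) (u p s q : R -> R)
    (U : 'rV[R]_N -> R) (x : 'rV[R]_N) (i : 'I_N) :
  radial_C2_data u p s q -> (forall y, unit_ball y -> U y = u (enorm y)) ->
  unit_ball x -> partial i U x = x ord0 i * q (enorm x).
Proof. by move=> h hU xB; have [_] := radial_is_derive i h hU xB. Qed.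

Lemma radial_is_derive2 (R : realType) (N : nat) (u p s q : R -> R)
    (U : 'rV[R]_N -> R) (x : 'rV[R]_N) (i j : 'I_N) :
  radial_C2_data u p s q -> (forall y, unit_ball y -> U y = u (enorm y)) ->
  unit_ball x ->
  is_derive x (delta_mx ord0 j) (partial i U)
   ((i == j)%:R * q (enorm x) +
    x ord0 i * x ord0 j / enorm x ^+ 2 * (s (enorm x) - q (enorm x))).
Proof.
move=> D hU xB.
have cq0 := radial_quotient_continuous D.
case: (D) => [_ hp _ pq _].
rewrite -[X in is_derive X](addr0 x) -[X in x + X](scale0r (delta_mx ord0 j)).
apply/is_derive_line.
have [e e0 eB] := unit_ball_line (delta_mx ord0 j) xB.
apply: (@is_derive_near _ (fun t => (x ord0 i + (i == j)%:R * t) *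
    q (enorm (x + t *: delta_mx ord0 j)))).
  exists e => // t; rewrite subr0 => /eB h; rewrite (radial_partial i D hU)//.
  by rewrite !mxE /= [_ * t]mulrC.
(* At the origin the second term of the formula is 0 because x_i = 0, and the slope along the line
   is (i == j) q |t|. Elsewhere q' = (s - q) / r. *)
have [->|x0] := eqVneq x 0.
  rewrite !mxE !mul0r addr0 (eqP (_ : enorm (0 : 'rV[R]_N) == 0)) ?enorm_eq0//.
  apply/is_derive1_caratheodory; exists (fun t => (i == j)%:R * q `|t|); split.
  - move=> z; rewrite !add0r enorm_delta_line; ring.
  - apply: cvgM; first exact: cvg_cst.
    by apply: cq0; rewrite lexx ltr01.
  - by rewrite normr0.
have r0 : 0 < enorm x by rewrite lt_neqAle enorm_ge0 eq_sym enorm_eq0 x0.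
have hq : is_derive (enorm (x + 0 *: delta_mx ord0 j)) 1 q
    ((s (enorm x) - q (enorm x)) / enorm x).
  rewrite scale0r addr0.
  have hr : 0 <= enorm x < 1 by rewrite enorm_ge0.
  have h := is_derive_lamM (hp _ hr)
    (is_derive_lamV (is_derive_lam_id (enorm x)) (lt0r_neq0 r0) erefl) erefl.
  apply: (@is_derive_near _ (fun t => p t * t^-1)).
    exists (enorm x) => // t; rewrite ltr_distl subrr => /andP[t0 _].
    by rewrite pq mulfK// gt_eqF.
  by apply: (is_derive_eq h); rewrite pq; field; rewrite gt_eqF.
have h1 := is_derive_lamD (is_derive_lamC (x ord0 i) 0)
  (is_derive_lamZ (c := (i == j)%:R) (is_derive_lam_id (0 : R)) erefl) erefl.
apply: (is_derive_lamM h1 (is_derive_lam_comp (is_derive_enorm_line j x0) hq erefl)).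
by rewrite scale0r addr0; field; rewrite gt_eqF.
Qed.

(** The delicate point is the origin: x_i x_j / |x|^2 has no limit there in general, but it is
    bounded by 1 and multiplies s - q, which tends to 0 because q 0 = s 0. *)
Lemma radial_C2_on (R : realType) (N : nat) (u p s q : R -> R)
    (U : 'rV[R]_N -> R) :
  radial_C2_data u p s q -> (forall y, unit_ball y -> U y = u (enorm y)) ->
  C2_on (@unit_ball R N) U.
Proof.
move=> D hU.
have cs0 (r : R) : 0 <= r < 1 -> {for r, continuous (fun t => s `|t|)}.
  by case: D => _ _ h _ _; exact: h.
have cq0 r := radial_quotient_continuous (r := r) D.
have q0 : q 0 = s 0 by case: D => _ _ _ _ [].
have ccoord (i : 'I_N) : continuous (fun x : 'rV[R]_N => x ord0 i) by exact: coord_continuous.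
split=> [|i j x xB]; last first.
  have [dx Dx] := radial_is_derive2 i j D hU xB.
  have rx : 0 <= enorm x < 1 by rewrite enorm_ge0.
  split; first by [].
  apply: (@near_continuous _ _ _ (fun x => (i == j)%:R * q (enorm x) +
    x ord0 i * x ord0 j / enorm x ^+ 2 * (s (enorm x) - q (enorm x)))).
    apply: filterS (unit_ball_near xB) => y yB.
    by have [_] := radial_is_derive2 i j D hU yB.
  have cq : {for x, continuous (fun y : 'rV[R]_N => q (enorm y))}.
    by apply: continuous_radial; exact: cq0.
  have cd : {for x, continuous (fun y : 'rV[R]_N => s (enorm y) - q (enorm y))}.
    have cs : {for x, continuous (fun y : 'rV[R]_N => s (enorm y))}.
      by apply: continuous_radial; exact: cs0.
    exact: continuous_lamB cs cq.
  apply: continuous_lamD.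
    by apply: continuous_lamM => //; exact: cst_continuous.
  have [x0|x0] := eqVneq x 0; last first.
    apply: continuous_lamM => //; apply: continuous_lamM.
      by apply: continuous_lamM; exact: ccoord.
    apply: continuous_lamV; last by rewrite expf_neq0// enorm_eq0.
    apply: (@continuous_comp _ _ _ (@enorm R N) (fun y : R => y ^+ 2)).
      exact: enorm_continuous.
    exact: exprn_continuous.
  have e0 : enorm x = 0 by apply/eqP; rewrite enorm_eq0 x0.
  apply: (continuous_zero_dominated cd); first by rewrite e0 q0 subrr.
  move=> y; rewrite normrM ler_piMl//.
  rewrite normrM normfV [`|enorm y ^+ 2|]ger0_norm ?sqr_ge0//.
  have [->|y0] := eqVneq (enorm y) 0; first by rewrite expr0n invr0 mulr0.
  have ey : 0 < enorm y by rewrite lt_neqAle enorm_ge0 eq_sym y0.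
  rewrite ler_pdivrMr ?exprn_gt0// mul1r normrM expr2.
  by apply: ler_pM => //; exact: coord_le_enorm.
move=> i x xB.
have [dx Dx] := radial_is_derive i D hU xB.
have rx : 0 <= enorm x < 1 by rewrite enorm_ge0.
split; first by [].
apply: (@near_continuous _ _ _ (fun x : 'rV[R]_N => x ord0 i * q (enorm x))).
  apply: filterS (unit_ball_near xB) => y yB; exact: (radial_partial i D hU yB).
have cq : {for x, continuous (fun y : 'rV[R]_N => q (enorm y))}.
  by apply: continuous_radial; exact: cq0.
exact: continuous_lamM (ccoord i x) cq.
Qed.

Lemma radial_laplacian (R : realType) (N : nat) (u p s q : R -> R)
    (U : 'rV[R]_N -> R) (x : 'rV[R]_N) :
  radial_C2_data u p s q -> (forall y, unit_ball y -> U y = u (enorm y)) ->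
  unit_ball x ->
  laplacian U x = s (enorm x) + (N%:R - 1) * q (enorm x).
Proof.
move=> D hU xB.
have -> : laplacian U x = \sum_(i < N) (q (enorm x) +
    x ord0 i ^+ 2 * ((s (enorm x) - q (enorm x)) / enorm x ^+ 2)).
  apply: eq_bigr => i _; have [_] := radial_is_derive2 i i D hU xB.
  by rewrite /partial eqxx mul1r => ->; rewrite expr2; ring.
rewrite big_split /= sumr_const card_ord -mulr_suml -sqr_enorm -mulr_natl.
have [e0|x0] := eqVneq (enorm x) 0; last by field.
have q0 : q 0 = s 0 by case: D => _ _ _ _ [].
rewrite e0 q0; ring.
Qed.

Lemma radial_gradient (R : realType) (N : nat) (u p s q : R -> R)
    (U : 'rV[R]_N -> R) (x : 'rV[R]_N) :
  radial_C2_data u p s q -> (forall y, unit_ball y -> U y = u (enorm y)) ->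
  unit_ball x ->
  enorm (gradient U x) ^+ 2 = p (enorm x) ^+ 2.
Proof.
move=> D hU xB; rewrite sqr_enorm.
have -> : p (enorm x) = q (enorm x) * enorm x by case: D.
rewrite exprMn [enorm x ^+ 2]sqr_enorm mulr_sumr; apply: eq_bigr => i _.
by rewrite mxE (radial_partial i D hU xB) exprMn mulrC.
Qed.

(** * Passage between radial solutions and the singular radial equation *)

Lemma closed_unit_ballE (R : realType) (N : nat) (x : 'rV[R]_N) :
  closed_unit_ball x -> unit_ball x \/ unit_sphere x.
Proof.
by rewrite /closed_unit_ball /unit_ball /unit_sphere /= le_eqVlt => /orP[/eqP|]; [right|left].
Qed.

Lemma radial_regular_solution_of_ode (R : realType) (N : nat) (lambda delta : R)
    (u p s q : R -> R) (U : 'rV[R]_N -> R) :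
  radial_C2_data u p s q ->
  (forall y, closed_unit_ball y -> U y = u (enorm y)) ->
  {for 1, continuous u} -> u 1 = 0 ->
  (forall r, 0 <= r < 1 -> 0 < u r < 1) ->
  (forall r, 0 <= r < 1 ->
     - (s r + (N%:R - 1) * q r) = (lambda + delta * p r ^+ 2) / (1 - u r)) ->
  radial_regular_solution lambda delta U.
Proof.
move=> D hU cu1 u1 u01 ode.
have hU' y : unit_ball y -> U y = u (enorm y) by move/unit_ballW; exact: hU.
have hr (x : 'rV[R]_N) : unit_ball x -> 0 <= enorm x < 1.
  by rewrite enorm_ge0.
split; last by exists u.
split.
- split.
  + exact: radial_C2_on D hU'.
  + apply: (@subspace_eq_continuous _ _ _ (fun y => u (enorm y))).
      by move=> y; rewrite inE => /hU e; rewrite /from_subspace e.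
    apply: continuous_in_subspaceT => x; rewrite inE => xB.
    apply: continuous_radial.
    suff : {for enorm x, continuous u}.
      move=> cu; apply: (@continuous_comp _ _ _ (fun t : R => `|t|) u).
        exact: norm_continuous.
      by rewrite ger0_norm// enorm_ge0.
    case: (closed_unit_ballE xB) => [/hr xr|->//].
    by case: (D) => h _ _ _ _; exact: is_derive_continuous (h _ xr).
  + by move=> x xS; rewrite hU ?xS// /closed_unit_ball /= xS.
- by move=> x xB; rewrite hU'// u01// hr.
- by move=> x xB; rewrite (radial_laplacian D hU')// (radial_gradient D hU')// hU'// ode// hr.
Qed.

(** U is restricted to a full diameter, so that derivatives at 0 are two-sided. Radiality makes the
    restriction even, hence p 0 = 0, and q is the Caratheodory slope of p at 0. *)
Lemma ode_of_radial_regular_solution (R : realType) (N : nat) (lambda delta : R)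
    (U : 'rV[R]_N -> R) :
  (0 < N)%N -> radial_regular_solution lambda delta U ->
  exists u p s q : R -> R,
    radial_C2_data u p s q /\
    [/\ forall y, closed_unit_ball y -> U y = u (enorm y),
      {within `[0, 1], continuous u}, u 1 = 0,
      forall r, 0 <= r < 1 -> 0 < u r < 1
    & forall r, 0 <= r < 1 ->
      - (s r + (N%:R - 1) * q r) = (lambda + delta * p r ^+ 2) / (1 - u r)].
Proof.
move=> N0 [[[[C1 C2] cU U0] U01 eqU] [v hv]].
pose i0 := Ordinal N0; pose e : 'rV[R]_N := delta_mx ord0 i0.
have ee r : enorm (r *: e) = `|r| by exact: enorm_delta_line.
have eB (r : R) : -1 < r < 1 -> unit_ball (r *: e).
  by rewrite /unit_ball /= ee ltr_norml.
pose u r := U (r *: e); pose p r := partial i0 U (r *: e).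
pose s r := partial i0 (partial i0 U) (r *: e).
have line0 (V : 'rV[R]_N -> R) r d :
    is_derive (r *: e) e V d -> is_derive r 1 (fun t => V (t *: e)) d.
  move=> h; have -> : (fun t : R => V (t *: e)) = (fun t => V (0 + t *: e)).
    by apply/funext => t; rewrite add0r.
  by apply/is_derive_line; rewrite add0r.
have hu (r : R) : -1 < r < 1 -> is_derive r 1 u (p r).
  by move=> /eB rB; apply: line0; have [/derivableP] := C1 i0 _ rB.
have hp (r : R) : -1 < r < 1 -> is_derive r 1 p (s r).
  by move=> /eB rB; apply: line0; have [/derivableP] := C2 i0 i0 _ rB.
have cs (r : R) : -1 < r < 1 -> {for r, continuous s}.
  move=> /eB rB; have [_ h] := C2 i0 i0 _ rB.
  have ce : {for r, continuous (fun t : R => t *: e)} by exact: scalel_continuous.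
  exact: (@continuous_comp _ _ _ (fun t : R => t *: e) _ r ce h).
have uE (r : R) : -1 <= r <= 1 -> u r = v `|r|.
  by rewrite -ler_norml -ee => h; exact: hv.
have I0 : -1 < (0 : R) < 1 by rewrite ltr01 oppr_lt0 ltr01.
have p0 : p 0 = 0.
  have h : is_derive (0 : R) 1 u (- p 0).
    apply: (@is_derive_near _ (fun t => u (- t))).
      exists 1 => // t; rewrite subr0 ltr_norml => /andP[t1 t2].
      by rewrite !uE ?normrN//; lra.
    have hN := is_derive_lamN (is_derive_lam_id (0 : R)) erefl.
    apply: (is_derive_lam_comp hN (df := p 0)); last by rewrite mulrN1.
    by rewrite oppr0; exact: hu.
  have [_ h1] := h; have [_ h2] := hu 0 I0.
  by move: h1; rewrite h2; lra.
have [q [qE cq q0]] := (is_derive1_caratheodory p 0 (s 0)).1 (hp 0 I0).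
have II (r : R) : 0 <= r < 1 -> -1 < r < 1 by move=> /andP[? ?]; lra.
have D : radial_C2_data u p s q.
  split=> [r /II|r /II|r|r|//].
  - exact: hu.
  - exact: hp.
  - move=> h; apply: (@continuous_comp _ _ _ (fun t : R => `|t|) s).
      exact: norm_continuous.
    by apply: cs; rewrite ger0_norm; [exact: II|case/andP: h].
  - by have := qE r; rewrite p0 !subr0.
have hU (y : 'rV[R]_N) : closed_unit_ball y -> U y = u (enorm y).
  move=> yB; rewrite hv// uE.
    by rewrite ger0_norm// enorm_ge0.
  by rewrite (le_trans _ (enorm_ge0 y)) ?oppr_le0//= .
have hU' (y : 'rV[R]_N) : unit_ball y -> U y = u (enorm y).
  by move/unit_ballW; exact: hU.
exists u, p, s, q; split => //; split => //.
- apply/subspace_continuousP => r /=; rewrite in_itv /= => /andP[r0 r1].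
  have rB : closed_unit_ball (r *: e) by rewrite /closed_unit_ball /= ee ger0_norm.
  have := (subspace_continuousP _ _).1 cU _ rB; apply: cvg_comp => P.
  rewrite /within /= => hP.
  have ce : {for r, continuous (fun t : R => t *: e)} by exact: scalel_continuous.
  have {}hP : \forall t \near r, closed_unit_ball (t *: e) -> P (t *: e) := ce _ hP.
  change (\forall t \near r, `[0, 1]%classic t -> P (t *: e)).
  apply: filterS hP => t h; rewrite /= in_itv /= => /andP[t0 t1]; apply: h.
  by rewrite /closed_unit_ball /= ee ger0_norm.
- by apply: U0; rewrite /unit_sphere /= ee normr1.
- by move=> r /II /eB /U01.
- move=> r hr; have rB := eB _ (II _ hr).
  have rE : enorm (r *: e) = r by rewrite ee ger0_norm//; case/andP: hr.
  have := eqU _ rB.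
  by rewrite (radial_laplacian D hU' rB) (radial_gradient D hU' rB) rE.
Qed.

(** * The normalized radial solution *)

(* T = 1 / S is the solution of T (T'' + (N - 1) T' / r) = 1 + delta T'^2 with
   T 0 = 1 and T' 0 = 0; it may blow up at a finite radius, where S vanishes.
   The functions P and Q are T' and T''. *)
Record ode_profile (R : realType) (N : nat) (delta : R) (S P Q : R -> R) : Prop :=
  OdeProfile {
  profile_continuous : continuous S;
  profile0 : S 0 = 1;
  profile_ge0 : forall r, 0 <= S r;
  profile_noninc : forall a b, 0 <= a -> a <= b -> S b <= S a;
  profile_derive : forall r : R, 0 <= r -> 0 < S r ->
    is_derive r 1 (fun t => (S t)^-1) (P r);
  profile_derive2 : forall r : R, 0 <= r -> 0 < S r -> is_derive r 1 P (Q r);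
  profile_continuous2 : forall r : R, 0 <= r -> 0 < S r ->
    {for r, continuous (fun t => Q `|t|)};
  profile_derive0 : P 0 = 0;
  profile_second0 : Q 0 = N%:R^-1;
  profile_ode : forall r, 0 < r -> 0 < S r ->
    Q r + (N%:R - 1) * (P r / r) = (1 + delta * P r ^+ 2) * S r
  }.

Lemma profile_continuous_at (R : realType) (N : nat) (delta : R) (S P Q : R -> R)
    (r : R) : ode_profile N delta S P Q -> {for r, continuous S}.
Proof. by move=> H; exact: (profile_continuous H). Qed.

Lemma profile_gt0 (R : realType) (N : nat) (delta : R) (S P Q : R -> R) (b r : R) :
  ode_profile N delta S P Q -> 0 < S b -> 0 <= r <= b -> 0 < S r.
Proof.
by move=> H Sb /andP[r0 rb]; apply: lt_le_trans Sb _; exact: profile_noninc H _ _ _ _.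
Qed.

(* A Pohozaev-type monotonicity: T (T'' - T' / r) r^N T^(-2 delta) has derivative
   (2 delta - N) r^(N-1) T'^2 T^(-2 delta), and this is where delta >= N/2 enters. *)
Lemma profile_gap_ge0 (R : realType) (N : nat) (delta : R) (S P Q : R -> R) (b : R) :
  (2 <= N)%N -> N%:R / 2 <= delta -> ode_profile N delta S P Q ->
  0 < b -> 0 < S b -> P b / b <= Q b.
Proof.
move=> N2 dN H b0 Sb.
have [n hn] : exists n, N = n.+2 by exists (N - 2)%N; rewrite -addn2 subnK.
have NE : N%:R = n%:R + 2 :> R by rewrite hn -natr1 -natr1; ring.
have S0 r : 0 <= r <= b -> 0 < S r by exact: profile_gt0 H Sb.
(* By the equation A = r T (T'' - T' / r); in this form T'' is eliminated and A can be
   differentiated. E is T^(-2 delta), so M is the quantity described above. *)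
pose A r := r * (1 + delta * P r ^+ 2) - N%:R * ((S r)^-1 * P r).
pose E r := expR (2 * delta * ln (S r)).
pose M r := r ^+ n.+1 * A r * E r.
have dS r : 0 <= r <= b -> is_derive r 1 S (- P r * S r ^+ 2).
  move=> hr; have Sr := S0 _ hr; case/andP: (hr) => r0 _.
  have h := is_derive_lamV (profile_derive H r0 Sr) _ erefl.
  have -> : S = (fun t => (S t)^-1^-1) by apply/funext => t; rewrite invrK.
  apply: (is_derive_eq (h _)); first by rewrite invr_eq0 gt_eqF.
  by rewrite invrK; field; rewrite gt_eqF.
have dA r : 0 <= r <= b -> is_derive r 1 A (1 + delta * P r ^+ 2 +
    2 * delta * r * P r * Q r - N%:R * P r ^+ 2 - N%:R * ((S r)^-1 * Q r)).
  move=> hr; have Sr := S0 _ hr; case/andP: (hr) => r0 _.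
  have h1 := is_derive_lamX (n := 2%N) (profile_derive2 H r0 Sr) erefl.
  have {}h1 := is_derive_lamD (is_derive_lamC 1 r) (is_derive_lamZ (c := delta) h1 erefl) erefl.
  have {}h1 := is_derive_lamM (is_derive_lam_id r) h1 erefl.
  have h2 := is_derive_lamM (profile_derive H r0 Sr) (profile_derive2 H r0 Sr) erefl.
  apply: (is_derive_lamB h1 (is_derive_lamZ (c := N%:R) h2 erefl)).
  by rewrite /=; ring.
have dE r : 0 <= r <= b -> is_derive r 1 E (E r * (- (2 * delta * (P r * S r)))).
  move=> hr; have Sr := S0 _ hr.
  have h := is_derive_lam_comp (dS r hr) (is_derive1_ln Sr) erefl.
  have {}h := is_derive_lamZ (c := 2 * delta) h erefl.
  apply: (is_derive_lam_comp h (is_derive_expR _)).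
  by rewrite /E; congr (_ * _); field; rewrite gt_eqF.
(* The equation, hence the closed formula, is available for r > 0 only; at 0 differentiability
   serves just for continuity. *)
have dM r : 0 <= r <= b -> exists d, is_derive r 1 M d /\
    (0 < r -> d = (2 * delta - N%:R) * r ^+ n.+1 * P r ^+ 2 * E r).
  move=> hr; have Sr := S0 _ hr.
  have h := is_derive_lamM (is_derive_lamX (n := n.+1) (is_derive_lam_id r) erefl) (dA r hr) erefl.
  have {}h := is_derive_lamM h (dE r hr) erefl.
  eexists; split; first exact: h.
  move=> r0; have := profile_ode H r0 Sr.
  rewrite NE => e.
  have {e}-> : Q r = (1 + delta * P r ^+ 2) * S r - (n%:R + 1) * (P r / r).
    by rewrite -e; ring.
  rewrite /A NE (exprS r n) /= -(natr1 n); field.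
  by rewrite !gt_eqF.
have : M 0 <= M b.
  apply: (@derive_ge0_le R M (fun r => (2 * delta - N%:R) * r ^+ n.+1 * P r ^+ 2 * E r)).
  - exact: ltW.
  - move=> r /andP[r0 rb]; have [|d [hd de]] := dM r; first by rewrite !ltW.
    by rewrite -(de r0).
  - move=> r /andP[r0 rb]; rewrite mulr_ge0 ?expR_ge0// mulr_ge0 ?sqr_ge0//.
    by rewrite mulr_ge0 ?exprn_ge0 ?(ltW r0)//; lra.
  - apply: continuous_segment => r hr; have [d [hd _]] := dM r hr.
    exact: is_derive_continuous hd.
rewrite /M expr0n !mul0r pmulr_lge0 ?expR_gt0// pmulr_rge0 ?exprn_gt0//.
have := profile_ode H b0 Sb; rewrite /A => e h.
rewrite -(ler_pM2r b0) divfK ?gt_eqF//.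
have -> : Q b = (1 + delta * P b ^+ 2) * S b - (N%:R - 1) * (P b / b).
  by rewrite -e; ring.
rewrite -subr_ge0.
have -> : ((1 + delta * P b ^+ 2) * S b - (N%:R - 1) * (P b / b)) * b - P b =
  (b * (1 + delta * P b ^+ 2) - N%:R * ((S b)^-1 * P b)) * S b.
  by field; rewrite !gt_eqF.
by rewrite mulr_ge0// ltW.
Qed.

(** T' / r has derivative (T'' - T' / r) / r >= 0 and tends to T''(0) = 1 / N at 0. *)
Lemma profile_derive_lower (R : realType) (N : nat) (delta : R) (S P Q : R -> R) (b : R) :
  (2 <= N)%N -> N%:R / 2 <= delta -> ode_profile N delta S P Q ->
  0 < b -> 0 < S b -> N%:R^-1 <= P b / b.
Proof.
move=> N2 dN H b0 Sb.
have S0 r : 0 <= r <= b -> 0 < S r by exact: profile_gt0 H Sb.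
have [g [gE cg g0]] := (is_derive1_caratheodory _ _ _).1
  (profile_derive2 H (lexx 0) (S0 0 (introT andP (conj (lexx 0) (ltW b0))))).
have {}gE z : P z = g z * z by have := gE z; rewrite (profile_derive0 H) !subr0.
have dg r : 0 < r <= b -> is_derive r 1 g ((Q r - P r / r) / r).
  move=> /andP[r0 rb]; have Sr : 0 < S r by apply: S0; rewrite ltW.
  have h := is_derive_lamM (profile_derive2 H (ltW r0) Sr)
    (is_derive_lamV (is_derive_lam_id r) (lt0r_neq0 r0) erefl) erefl.
  apply: (@is_derive_near _ (fun t => P t * t^-1)).
    exists r => // t; rewrite ltr_distl subrr => /andP[t0 _].
    by rewrite gE mulfK// gt_eqF.
  by apply: (is_derive_eq h); field; rewrite gt_eqF.
have -> : N%:R^-1 = g 0 by rewrite g0 (profile_second0 H).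
rewrite gE mulfK ?gt_eqF//.
apply: (@derive_ge0_le R g (fun r => (Q r - P r / r) / r)).
- exact: ltW.
- by move=> r /andP[r0 rb]; apply: dg; rewrite r0 ltW.
- move=> r /andP[r0 rb]; rewrite divr_ge0 ?(ltW r0)// subr_ge0.
  by apply: (profile_gap_ge0 N2 dN H r0); apply: S0; rewrite !ltW.
- apply: continuous_segment => r /andP[]; rewrite le_eqVlt => /orP[/eqP<-//|r0 rb].
  by apply: is_derive_continuous (dg r _); rewrite r0.
Qed.

(** Integration of T' >= r / N: the profile for delta = N / 2 is the smallest one. *)
Lemma profile_lower (R : realType) (N : nat) (delta : R) (S P Q : R -> R) (b : R) :
  (2 <= N)%N -> N%:R / 2 <= delta -> ode_profile N delta S P Q ->
  0 <= b -> 0 < S b -> 1 + b ^+ 2 / (2 * N%:R) <= (S b)^-1.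
Proof.
move=> N2 dN H b0 Sb.
have N0 : 0 < N%:R :> R by rewrite ltr0n ltnW.
have S0 r : 0 <= r <= b -> 0 < S r by exact: profile_gt0 H Sb.
pose f r := (S r)^-1 - (2 * N%:R)^-1 * r ^+ 2.
have df r : 0 <= r <= b -> is_derive r 1 f (P r - r / N%:R).
  move=> hr; have Sr := S0 _ hr; case/andP: (hr) => r0 _.
  apply: (is_derive_lamB (profile_derive H r0 Sr) (is_derive_lamZ (c := (2 * N%:R)^-1)
    (is_derive_lamX (n := 2%N) (is_derive_lam_id r) erefl) erefl)).
  by rewrite /=; field; rewrite gt_eqF.
have : f 0 <= f b.
  apply: (derive_ge0_le b0 (df := fun r => P r - r / N%:R)).
  - by move=> r /andP[r0 rb]; apply: df; rewrite !ltW.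
  - move=> r /andP[r0 rb]; rewrite subr_ge0 mulrC -ler_pdivlMr//.
    by apply: (profile_derive_lower N2 dN H r0); apply: S0; rewrite !ltW.
  - by apply: continuous_segment => r hr; exact: is_derive_continuous (df r hr).
rewrite /f (profile0 H) invr1 expr0n mulr0 subr0 mulrC; lra.
Qed.

(* The sign of T - r T' decides the monotonicity of r / T. *)
Lemma profile_tangent_decr (R : realType) (N : nat) (delta : R) (S P Q : R -> R) (a b : R) :
  (2 <= N)%N -> N%:R / 2 <= delta -> ode_profile N delta S P Q ->
  0 <= a -> a < b -> 0 < S b ->
  (S b)^-1 - b * P b <= (S a)^-1 - a * P a - (b ^+ 2 - a ^+ 2) / (2 * N%:R).
Proof.
move=> N2 dN H a0 ab Sb.
have N0 : 0 < N%:R :> R by rewrite ltr0n ltnW.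
have S0 r : 0 <= r <= b -> 0 < S r by exact: profile_gt0 H Sb.
(* Here f' = r / N - r T'' <= 0, since T'' >= T' / r >= 1 / N. *)
pose f r := (S r)^-1 - r * P r + (2 * N%:R)^-1 * r ^+ 2.
have df r : 0 <= r <= b -> is_derive r 1 f (r / N%:R - r * Q r).
  move=> hr; have Sr := S0 _ hr; case/andP: (hr) => r0 _.
  have h1 := is_derive_lamM (is_derive_lam_id r) (profile_derive2 H r0 Sr) erefl.
  have {}h1 := is_derive_lamB (profile_derive H r0 Sr) h1 erefl.
  apply: (is_derive_lamD h1 (is_derive_lamZ (c := (2 * N%:R)^-1)
    (is_derive_lamX (n := 2%N) (is_derive_lam_id r) erefl) erefl)).
  by rewrite /=; field; rewrite gt_eqF.
have : f b <= f a.
  apply: (derive_le0_ge (ltW ab) (df := fun r => r / N%:R - r * Q r)).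
  - by move=> r /andP[r0 rb]; apply: df; rewrite (le_trans a0 (ltW r0)) ltW.
  - move=> r /andP[ar rb]; have r0 : 0 < r by exact: le_lt_trans ar.
    have Sr : 0 < S r by apply: S0; rewrite !ltW.
    rewrite subr_le0 ler_pM2l//.
    exact: le_trans (profile_derive_lower N2 dN H r0 Sr) (profile_gap_ge0 N2 dN H r0 Sr).
  - apply: continuous_segment => r /andP[ar rb]; apply: (is_derive_continuous (df r _)).
    by rewrite rb andbT (le_trans a0).
rewrite /f mulrBl ![(2 * N%:R)^-1 * _]mulrC; lra.
Qed.

Lemma is_derive_profile_ratio (R : realType) (N : nat) (delta : R) (S P Q : R -> R) (r : R) :
  ode_profile N delta S P Q -> 0 <= r -> 0 < S r ->
  is_derive r 1 (fun t : R => t * S t) (((S r)^-1 - r * P r) * S r ^+ 2).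
Proof.
move=> H r0 Sr.
have h := is_derive_lamV (profile_derive H r0 Sr) _ erefl.
have -> : (fun t => t * S t) = (fun t => t * (S t)^-1^-1).
  by apply/funext => t; rewrite invrK.
apply: (is_derive_lamM (is_derive_lam_id r) (h _)).
  by rewrite invr_eq0 gt_eqF.
by rewrite !invrK; field; rewrite gt_eqF.
Qed.

Lemma continuous_profile_ratio (R : realType) (N : nat) (delta : R) (S P Q : R -> R) (r : R) :
  ode_profile N delta S P Q -> {for r, continuous (fun t : R => t * S t)}.
Proof.
move=> H; apply: continuous_lamM; first exact: (is_derive_continuous (is_derive_lam_id r)).
exact: (profile_continuous H).
Qed.

(** With g = T - r T', the derivative of h = r / T is g / T^2. Here g strictly decreases from g 0 =
    1 and is at most 1 - r^2 / (2 N), so it is nonpositive from k = sqrt (2 N) on, as long as T is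
    finite. *)
Lemma profile_ratio_unimodal (R : realType) (N : nat) (delta : R) (S P Q : R -> R) :
  (2 <= N)%N -> N%:R / 2 <= delta -> ode_profile N delta S P Q ->
  exists2 m, 0 < m & [/\ 0 < S m,
    forall a b, 0 <= a -> a < b -> b <= m -> a * S a < b * S b,
    forall a b, m <= a -> a < b -> 0 < S b -> b * S b < a * S a
  & forall e, 0 < e -> exists2 b, m < b & b * S b < e].
Proof.
move=> N2 dN H.
have N0 : 0 < N%:R :> R by rewrite ltr0n ltnW.
pose h r := r * S r; pose g r := (S r)^-1 - r * P r.
pose k : R := Num.sqrt (2 * N%:R).
have k0 : 0 < k by rewrite sqrtr_gt0 mulr_gt0.
have k2 : k ^+ 2 = 2 * N%:R by rewrite sqr_sqrtr// mulr_ge0// ltW.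
have ch r : {for r, continuous h} by exact: continuous_profile_ratio H.
have g0 : g 0 = 1 by rewrite /g (profile0 H) mul0r subr0 invr1.
have gle b : 0 < b -> 0 < S b -> g b <= 1 - b ^+ 2 / (2 * N%:R).
  move=> b0 Sb; have := profile_tangent_decr N2 dN H (lexx 0) b0 Sb.
  by rewrite -/(g b) -/(g 0) g0 expr0n subr0.
(* The interval extends 1 beyond k; since the maximum point turns out to lie in (0, k], it is
   interior and g vanishes there. *)
have [m /andP[m0 mk] hm] : exists2 c, 0 <= c <= k + 1 &
    forall x, 0 <= x <= k + 1 -> h x <= h c.
  by apply: segment_max => [|x _]; [lra|exact: ch].
have gdecr a b : 0 <= a -> a < b -> 0 < S b -> g b < g a.
  move=> a0 ab Sb; apply: le_lt_trans (profile_tangent_decr N2 dN H a0 ab Sb) _.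
  rewrite ltrBlDr ltrDl divr_gt0 ?mulr_gt0// subr_gt0 ltr_sqr ?nnegrE//.
  by rewrite (le_trans a0 (ltW ab)).
have hincr a b : 0 <= a -> a < b -> 0 < S b -> 0 <= g b -> h a < h b.
  move=> a0 ab Sb gb.
  apply: (derive_gt0_lt ab (df := fun r => g r * S r ^+ 2)) => [r|r|].
  - move=> /andP[ar rb]; have r0 := le_lt_trans a0 ar.
    apply: (is_derive_profile_ratio H (ltW r0)); apply: (profile_gt0 H Sb).
    by rewrite !ltW.
  - move=> /andP[ar rb]; have r0 := le_lt_trans a0 ar.
    rewrite mulr_gt0//; first exact: le_lt_trans gb (gdecr _ _ (ltW r0) rb Sb).
    by rewrite exprn_gt0//; apply: (profile_gt0 H Sb); rewrite !ltW.
  - by apply: continuous_segment.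
have hdecr a b : 0 <= a -> a < b -> 0 < S b -> g a <= 0 -> h b < h a.
  move=> a0 ab Sb ga.
  apply: (derive_lt0_gt ab (df := fun r => g r * S r ^+ 2)) => [r|r|].
  - move=> /andP[ar rb]; have r0 := le_lt_trans a0 ar.
    apply: (is_derive_profile_ratio H (ltW r0)); apply: (profile_gt0 H Sb).
    by rewrite !ltW.
  - move=> /andP[ar rb]; have r0 := le_lt_trans a0 ar.
    have Sr : 0 < S r by apply: (profile_gt0 H Sb); rewrite !ltW.
    rewrite pmulr_llt0 ?exprn_gt0//.
    exact: lt_le_trans (gdecr _ _ a0 ar Sr) ga.
  - by apply: continuous_segment.
have [z z0 [zk hz]] : exists2 z, 0 < z & z <= k + 1 /\ 0 < h z.
  have /continuous_dist /(_ 1 ltr01)[d d0 hd] := profile_continuous_at (r := 0) H.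
  have mm : 0 < Num.min d 1 by rewrite lt_min d0 ltr01.
  have [m1 m2] : Num.min d 1 <= d /\ Num.min d 1 <= 1 by rewrite !ge_min !lexx orbT.
  exists (Num.min d 1 / 2); first lra.
  split; first lra.
  rewrite mulr_gt0//; first lra.
  have /hd : `|Num.min d 1 / 2 - 0| < d by rewrite subr0 gtr0_norm; lra.
  by rewrite (profile0 H) ltr_distl subrr => /andP[].
have hm0 : 0 < h m by apply: lt_le_trans hz (hm _ _); rewrite zk ltW.
have m0' : 0 < m.
  by rewrite lt_neqAle m0 andbT; apply/eqP => mE; move: hm0; rewrite /h -mE mul0r ltxx.
have Sm : 0 < S m by move: hm0; rewrite /h pmulr_rgt0.
have mlek : m <= k.
  rewrite leNgt; apply/negP => km.
  have Sk : 0 < S k by apply: (profile_gt0 H Sm); rewrite !ltW.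
  have gk : g k <= 0.
    apply: le_trans (gle _ k0 Sk) _.
    by rewrite k2 divff ?subrr// gt_eqF// mulr_gt0.
  have := hdecr _ _ (ltW k0) km Sm gk; apply/negP; rewrite -leNgt.
  by apply: hm; rewrite (ltW k0)/=; lra.
have gm : g m = 0.
  have [S2 Sd] := is_derive_profile_ratio H m0 Sm.
  have [d d0 hd] : exists2 d : R, 0 < d & forall y, `|y - m| < d -> 0 < S y.
    have /continuous_dist /(_ _ Sm)[d d0 hd] := profile_continuous_at (r := m) H.
    by exists d => // y /hd; rewrite ltr_distl subrr => /andP[].
  have mm : 0 < Num.min d (Num.min m 1) by rewrite !lt_min d0 m0' ltr01.
  have le3 : Num.min d (Num.min m 1) <= d /\ Num.min d (Num.min m 1) <= m /\
    Num.min d (Num.min m 1) <= 1.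
    by rewrite !ge_min !lexx !orbT.
  case: le3 => [m1 [m2 m3]].
  have near_m y : `|y - m| < Num.min d (Num.min m 1) -> 0 <= y <= k + 1 /\ 0 < S y.
    move=> hy; split; last by apply: hd; lra.
    by move: hy; rewrite ltr_distl => /andP[y1 y2]; apply/andP; split; lra.
  have : g m * S m ^+ 2 = 0.
    apply: (@interior_max_derive0 R h m _ _ mm).
    - exact: is_derive_profile_ratio H m0 Sm.
    - move=> y /near_m[/andP[y0 _] Sy].
      by have [dy _] := is_derive_profile_ratio H y0 Sy; exact: derivableP.
    - by move=> y /near_m[yk _]; exact: hm.
  by move/eqP; rewrite mulf_eq0 expf_eq0 /= (gt_eqF Sm) orbF => /eqP.
exists m => //; split => //.
- move=> a b a0 ab; rewrite le_eqVlt => /orP[/eqP bm|bm].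
    by rewrite bm; apply: hincr; rewrite -?bm// bm ?gm.
  apply: hincr => //; first by apply: (profile_gt0 H Sm); rewrite (ltW bm) (le_trans a0 (ltW ab)).
  by rewrite -gm ltW// gdecr// (le_trans a0 (ltW ab)).
- move=> a b ma ab Sb; apply: hdecr => //; first exact: le_trans ma.
  move: ma; rewrite le_eqVlt => /orP[/eqP<-|ma]; first by rewrite gm.
  rewrite -gm ltW// gdecr//; apply: (profile_gt0 H Sb).
  by rewrite (ltW ab) (le_trans m0 (ltW ma)).
(* Either T has blown up and h b = 0, or T > b^2 / (2 N) gives h b < 2 N / b < e. *)
- move=> e e0; pose b := m + 1 + 2 * N%:R / e.
  have Ne : 0 < 2 * N%:R / e by rewrite divr_gt0// mulr_gt0.
  have b0 : 0 < b by rewrite /b; lra.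
  exists b; first by rewrite /b; lra.
  have [Sb|Sb] := ltP 0 (S b); last first.
    have -> : S b = 0 by apply/eqP; rewrite eq_le Sb (profile_ge0 H).
    by rewrite mulr0.
  have := profile_lower N2 dN H (ltW b0) Sb => hb.
  have hb' : b ^+ 2 / (2 * N%:R) < (S b)^-1 by lra.
  have : b ^+ 2 / (2 * N%:R) * S b < 1 by rewrite -ltr_pdivlMr// mul1r.
  have be : 2 * N%:R < b * e by rewrite -ltr_pdivrMr// /b; lra.
  move=> h1; have {}h1 : b * (b * S b) < 2 * N%:R.
    have -> : b * (b * S b) = b ^+ 2 / (2 * N%:R) * S b * (2 * N%:R).
      by field; rewrite gt_eqF.
    by rewrite gtr_pMl// mulr_gt0.
  by rewrite -(ltr_pM2l b0); exact: lt_trans h1 be.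
Qed.

(** * Correspondence and count of radial solutions *)

(* The energy E = (t1 - t2)^2 + (p1 - p2)^2 satisfies E' <= C E even though the
   equation is singular at 0, because the singular term only dissipates. *)
Lemma singular_ode_unique (R : realType) (lambda delta n b : R)
    (t1 p1 s1 t2 p2 s2 : R -> R) :
  0 <= n -> 0 <= b ->
  (forall r : R, 0 <= r <= b -> is_derive r 1 t1 (p1 r) /\ is_derive r 1 p1 (s1 r)) ->
  (forall r : R, 0 <= r <= b -> is_derive r 1 t2 (p2 r) /\ is_derive r 1 p2 (s2 r)) ->
  (forall r, 0 <= r <= b -> 0 < t1 r /\ 0 < t2 r) ->
  (forall r, 0 < r <= b -> s1 r + n * (p1 r / r) = (lambda + delta * p1 r ^+ 2) / t1 r) ->
  (forall r, 0 < r <= b -> s2 r + n * (p2 r / r) = (lambda + delta * p2 r ^+ 2) / t2 r) ->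
  t1 0 = t2 0 -> p1 0 = p2 0 -> t1 b = t2 b.
Proof.
move=> n0 b0 d1 d2 tpos ode1 ode2 t0 p0.
(* A and B are the coefficients of p1 - p2 and of -(t1 - t2) in the difference of the two right-hand
   sides. *)
pose A r := delta * (p1 r + p2 r) * (t1 r)^-1.
pose B r := (lambda + delta * p2 r ^+ 2) * (t1 r * t2 r)^-1.
have [|MA MA0 hA] := @segment_bounded R A 0 b b0.
  move=> r hr; have [dt1 dp1] := d1 r hr; have [dt2 dp2] := d2 r hr.
  have [t1r t2r] := tpos r hr.
  have h1 := is_derive_lamZ (c := delta) (is_derive_lamD dp1 dp2 erefl) erefl.
  exact: is_derive_continuous (is_derive_lamM h1 (is_derive_lamV dt1 (lt0r_neq0 t1r) erefl) erefl).
have [|MB MB0 hB] := @segment_bounded R B 0 b b0.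
  move=> r hr; have [dt1 dp1] := d1 r hr; have [dt2 dp2] := d2 r hr.
  have [t1r t2r] := tpos r hr.
  have h1 := is_derive_lamZ (c := delta) (is_derive_lamX (n := 2%N) dp2 erefl) erefl.
  have {}h1 := is_derive_lamD (is_derive_lamC lambda r) h1 erefl.
  have tt : t1 r * t2 r != 0 by rewrite mulf_neq0// gt_eqF.
  exact: is_derive_continuous (is_derive_lamM h1
    (is_derive_lamV (is_derive_lamM dt1 dt2 erefl) tt erefl) erefl).
(* With d = t1 - t2 and e = p1 - p2, the three terms bound 2 d e, -2 B d e and 2 A e^2; Gronwall's
   factor exp (- C r) then makes G nonincreasing from 0. *)
pose C := 1 + MB + 2 * MA.
pose E r := (t1 r - t2 r) ^+ 2 + (p1 r - p2 r) ^+ 2.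
pose E1 r := 2 * (t1 r - t2 r) * (p1 r - p2 r) + 2 * (p1 r - p2 r) * (s1 r - s2 r).
have dE r : 0 <= r <= b -> is_derive r 1 E (E1 r).
  move=> hr; have [dt1 dp1] := d1 r hr; have [dt2 dp2] := d2 r hr.
  apply: (is_derive_lamD (is_derive_lamX (n := 2%N) (is_derive_lamB dt1 dt2 erefl) erefl)
    (is_derive_lamX (n := 2%N) (is_derive_lamB dp1 dp2 erefl) erefl)).
  by rewrite /E1 /= !expr1.
have E1le r : 0 < r <= b -> E1 r <= C * E r.
  move=> /andP[r0 rb].
  have hr : 0 <= r <= b by rewrite ltW.
  have [t1r t2r] := tpos r hr.
  have hr' : 0 < r <= b by rewrite r0.
  have k0 : 0 <= n / r by rewrite divr_ge0// ltW.
  have es : s1 r - s2 r = - (n / r) * (p1 r - p2 r) + A r * (p1 r - p2 r) -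
      B r * (t1 r - t2 r).
    have := ode1 r hr'; have := ode2 r hr' => e2 e1.
    have -> : s1 r = (lambda + delta * p1 r ^+ 2) / t1 r - n * (p1 r / r).
      by rewrite -e1 addrK.
    have -> : s2 r = (lambda + delta * p2 r ^+ 2) / t2 r - n * (p2 r / r).
      by rewrite -e2 addrK.
    by rewrite /A /B; field; rewrite !gt_eqF.
  have := hA r hr; have := hB r hr; rewrite /E1 es /E /C.
  move: (A r) (B r) (n / r) (t1 r - t2 r) (p1 r - p2 r) k0 => {es}
    a bb k d e k0 /ler_normlP[b1 b2] /ler_normlP[a1 a2].
  have d2' := sqr_ge0 d; have e2' := sqr_ge0 e.
  have h1 : 0 <= k * e ^+ 2 by rewrite mulr_ge0.
  have h2 : a * e ^+ 2 <= MA * e ^+ 2 by rewrite ler_wpM2r.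
  have h3 : 0 <= MA * d ^+ 2 by rewrite mulr_ge0.
  have h4 : 0 <= (d - e) ^+ 2 by exact: sqr_ge0.
  have h5 : 0 <= (MB - bb) * (d - e) ^+ 2 by rewrite mulr_ge0// subr_ge0.
  have h6 : 0 <= (MB + bb) * (d + e) ^+ 2.
    by rewrite mulr_ge0 ?sqr_ge0//; lra.
  nra.
pose G r := E r * expR (- C * r).
have dG r : 0 <= r <= b -> is_derive r 1 G ((E1 r - C * E r) * expR (- C * r)).
  move=> hr.
  have h := is_derive_lam_comp
    (is_derive_lamZ (c := - C) (is_derive_lam_id r) erefl) (is_derive_expR _) erefl.
  by apply: (is_derive_lamM (dE r hr) h); ring.
have : G b <= G 0.
  apply: (derive_le0_ge b0 (df := fun r => (E1 r - C * E r) * expR (- C * r))).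
  - by move=> r /andP[r0 rb]; apply: dG; rewrite !ltW.
  - move=> r /andP[r0 rb]; rewrite mulr_le0_ge0 ?expR_ge0// subr_le0.
    by apply: E1le; rewrite r0 ltW.
  - by apply: continuous_segment => r hr; exact: is_derive_continuous (dG r hr).
rewrite /G {2}/E t0 p0 !subrr expr0n /= addr0 mul0r pmulr_lle0 ?expR_gt0// /E.
have := sqr_ge0 (t1 b - t2 b); have := sqr_ge0 (p1 b - p2 b) => h1 h2 h3.
have : (t1 b - t2 b) ^+ 2 = 0 by apply/eqP; rewrite eq_le h2 andbT; lra.
by move/eqP; rewrite expf_eq0 /= subr_eq0 => /eqP.
Qed.

Lemma profile_decr (R : realType) (N : nat) (delta : R) (S P Q : R -> R) (a b : R) :
  (2 <= N)%N -> N%:R / 2 <= delta -> ode_profile N delta S P Q ->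
  0 <= a -> a < b -> 0 < S b -> S b < S a.
Proof.
move=> N2 dN H a0 ab Sb.
have S0 r : 0 <= r <= b -> 0 < S r by exact: profile_gt0 H Sb.
have Sa : 0 < S a by apply: S0; rewrite a0 ltW.
rewrite -ltf_pV2//.
apply: (derive_gt0_lt ab (f := fun t => (S t)^-1) (df := P)).
- move=> r /andP[ar rb]; have r0 := le_lt_trans a0 ar.
  by apply: (profile_derive H (ltW r0)); apply: S0; rewrite !ltW.
- move=> r /andP[ar rb]; have r0 := le_lt_trans a0 ar.
  have Sr : 0 < S r by apply: S0; rewrite !ltW.
  have := profile_derive_lower N2 dN H r0 Sr => h.
  have : 0 < P r / r by apply: lt_le_trans h; rewrite invr_gt0 ltr0n ltnW.
  by rewrite pmulr_lgt0// invr_gt0.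
- apply: continuous_segment => r /andP[ar rb]; have r0 := le_trans a0 ar.
  have Sr : 0 < S r by apply: S0; rewrite r0.
  exact: is_derive_continuous (profile_derive H r0 Sr).
Qed.

Lemma profile_solution (R : realType) (N : nat) (delta rho : R) (S P Q : R -> R)
    (U : 'rV[R]_N -> R) :
  (2 <= N)%N -> N%:R / 2 <= delta -> ode_profile N delta S P Q ->
  0 < rho -> 0 < S rho ->
  (forall y, closed_unit_ball y -> U y = 1 - S rho * (S (rho * enorm y))^-1) ->
  radial_regular_solution ((rho * S rho) ^+ 2) delta U.
Proof.
move=> N2 dN H rho0 Srho hU.
have N0 : 0 < N%:R :> R by rewrite ltr0n ltnW.
have Sr (r : R) : 0 <= r <= 1 -> 0 < S (rho * r).
  move=> /andP[r0 r1]; apply: (profile_gt0 H Srho).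
  by rewrite mulr_ge0 ?(ltW rho0)//= ger_pMr.
set a := S rho in Srho hU *.
have rr r : 0 <= r -> 0 <= rho * r by move=> r0; rewrite mulr_ge0// ltW.
pose u r := 1 - a * (S (rho * r))^-1.
pose p r := - (a * rho * P (rho * r)).
pose s r := - (a * rho ^+ 2 * Q (rho * r)).
have drho (r : R) : is_derive r 1 (fun t => rho * t) rho.
  by apply: (is_derive_lamZ (is_derive_lam_id r)); rewrite mulr1.
have du (r : R) : 0 <= r <= 1 -> is_derive r 1 u (p r).
  move=> hr; have /andP[r0 r1] := hr.
  have h := is_derive_lam_comp (drho r) (profile_derive H (rr _ r0) (Sr _ hr)) erefl.
  apply: (is_derive_lamB (is_derive_lamC 1 r) (is_derive_lamZ (c := a) h erefl)).
  by rewrite /p; ring.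
have dp (r : R) : 0 <= r <= 1 -> is_derive r 1 p (s r).
  move=> hr; have /andP[r0 r1] := hr.
  have h := is_derive_lam_comp (drho r) (profile_derive2 H (rr _ r0) (Sr _ hr)) erefl.
  apply: (is_derive_lamN (is_derive_lamZ (c := a * rho) h erefl)).
  by rewrite /s; ring.
have W (r : R) : 0 <= r < 1 -> 0 <= r <= 1 by move=> /andP[-> /ltW].
have p0 : p 0 = 0 by rewrite /p mulr0 (profile_derive0 H) mulr0 oppr0.
have h01 : 0 <= (0 : R) <= 1 by rewrite lexx ler01.
have [q [qE cq q0]] := (is_derive1_caratheodory p 0 (s 0)).1 (dp 0 h01).
have {}qE r : p r = q r * r by have := qE r; rewrite p0 !subr0.
have D : radial_C2_data u p s q.
  split; [by move=> r /W /du|by move=> r /W /dp|move=> r /W hr|exact: qE|by []].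
  have /andP[r0 r1] := hr.
  have -> : (fun t => s `|t|) = (fun t => - (a * rho ^+ 2) * Q `|rho * t|).
    by apply/funext => t; rewrite /s normrM (gtr0_norm rho0) mulNr.
  apply: continuous_lamM; first exact: cst_continuous.
  apply: (@continuous_comp _ _ _ (fun t => rho * t) (fun t => Q `|t|)).
    exact: is_derive_continuous (drho r).
  exact: (@profile_continuous2 _ _ _ _ _ _ H _ (rr _ r0) (Sr _ hr)).
apply: (radial_regular_solution_of_ode D hU).
- by apply: (is_derive_continuous (du 1 _)); rewrite ler01 lexx.
- by rewrite /u mulr1 divff ?subrr// gt_eqF.
- move=> r hr; have := Sr _ (W _ hr) => S1; case/andP: hr => r0 r1.
  have lt : a < S (rho * r).
    apply: (profile_decr N2 dN H (rr _ r0)) => //.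
    by rewrite -[ltRHS]mulr1 ltr_pM2l.
  by rewrite /u subr_gt0 ltrBlDl ltrDr divr_gt0// andbT ltr_pdivrMr// mul1r.
- move=> r hr; have S1 := Sr _ (W _ hr); case/andP: hr => r0 r1.
  have -> : 1 - u r = a / S (rho * r) by rewrite /u; ring.
  move: r0; rewrite le_eqVlt => /orP[/eqP<-|r0].
    rewrite q0 p0 /s !mulr0 (profile_second0 H) (profile0 H).
    by field; rewrite !gt_eqF.
  have q1 : q r = p r / r by rewrite qE mulfK// gt_eqF.
  have := profile_ode H (mulr_gt0 rho0 r0) S1.
  rewrite q1 /s /p => e.
  have -> : Q (rho * r) = (1 + delta * P (rho * r) ^+ 2) * S (rho * r) -
     (N%:R - 1) * (P (rho * r) / (rho * r)) by rewrite -e; ring.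
  by field; rewrite !gt_eqF.
Qed.

(** If the difference were nonzero at 1, it would take half of that value at a point before 1, where
    it vanishes. *)
Lemma within_continuous_eq_end (R : realType) (f g : R -> R) :
  {within `[0, 1], continuous f} -> {within `[0, 1], continuous g} ->
  (forall r, 0 <= r < 1 -> f r = g r) -> f 1 = g 1.
Proof.
move=> cf cg fg.
have cd : {within `[0, 1], continuous (f - g)} by exact: within_continuousB.
pose d r := f r - g r.
have d0 : d 0 = 0 by rewrite /d fg ?subrr// lexx ltr01.
have [|c] := @IVT R d 0 1 (d 1 / 2) ler01 cd.
  by rewrite ge_min le_max d0; have [h|h] := leP 0 (d 1); apply/andP; split;
    apply/orP; [left|right|right|left]; lra.
rewrite in_itv /= => /andP[c0]; rewrite le_eqVlt => /orP[/eqP->|c1] e.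
  by apply/eqP; rewrite -subr_eq0 -/(d 1); apply/eqP; lra.
move: e; rewrite {1}/d fg ?c0// subrr => e.
by apply/eqP; rewrite -subr_eq0 -/(d 1); apply/eqP; lra.
Qed.

(** The scaled profile a T(c r) with a = 1 - u 0 and c = sqrt lambda / a has the initial data of 1 -
    u. Uniqueness applies only as long as T(c r) is finite, so blow-up up to r = 1 must be excluded;
    then u 1 = 0 gives S c = a. *)
Lemma solution_profile (R : realType) (N : nat) (lambda delta : R) (S P Q : R -> R)
    (U : 'rV[R]_N -> R) :
  (0 < N)%N -> ode_profile N delta S P Q -> 0 < lambda ->
  radial_regular_solution lambda delta U ->
  exists rho, [/\ 0 < rho, 0 < S rho, (rho * S rho) ^+ 2 = lambda &
    forall y, closed_unit_ball y -> U y = 1 - S rho * (S (rho * enorm y))^-1].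
Proof.
move=> N0 H l0 sol.
have [u [p [s [q [D [hU cu u1 u01 ode]]]]]] := ode_of_radial_regular_solution N0 sol.
have n0 : 0 <= N%:R - 1 :> R by rewrite subr_ge0 ler1n.
have Z : 0 <= (0 : R) < 1 by rewrite lexx ltr01.
pose a := 1 - u 0.
have /andP[a0 a1] : 0 < a < 1 by have := u01 0 Z; rewrite /a; lra.
pose c := Num.sqrt lambda / a.
have c0 : 0 < c by rewrite divr_gt0// sqrtr_gt0.
have ac : (a * c) ^+ 2 = lambda.
  by rewrite /c mulrCA divff ?gt_eqF// mulr1 sqr_sqrtr// ltW.
have cr r : 0 <= r -> 0 <= c * r by move=> r0; rewrite mulr_ge0// ltW.
have dc (r : R) : is_derive r 1 (fun t => c * t) c.
  by apply: (is_derive_lamZ (is_derive_lam_id r)); rewrite mulr1.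
have cS (r : R) : {for r, continuous (fun t => S (c * t))}.
  apply: (@continuous_comp _ _ _ (fun t => c * t) S).
    exact: is_derive_continuous (dc r).
  exact: profile_continuous_at H.
have S0 : S (c * 0) = 1 by rewrite mulr0 (profile0 H).
have eqt r : 0 <= r < 1 -> 0 < S (c * r) -> 1 - u r = a * (S (c * r))^-1.
  move=> hr Sr; have /andP[r0 r1] := hr.
  have Sx (x : R) : 0 <= x <= r -> 0 < S (c * x).
    move=> /andP[x0 xr]; apply: (profile_gt0 H Sr).
    by rewrite cr// ler_pM2l.
  have W (x : R) : 0 <= x <= r -> 0 <= x < 1.
    by move=> /andP[-> xr]; exact: le_lt_trans r1.
  case: (D) => hu hp _ pq _.
  apply: (@singular_ode_unique R lambda delta (N%:R - 1) r
    (fun r => 1 - u r) (fun r => - p r) (fun r => - s r)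
    (fun r => a * (S (c * r))^-1) (fun r => a * c * P (c * r))
    (fun r => a * c ^+ 2 * Q (c * r)) n0 r0).
  - move=> x /W hx; split; last exact: is_derive_lamN (hp x hx) erefl.
    by apply: (is_derive_lamB (is_derive_lamC 1 x) (hu x hx)); rewrite sub0r.
  - move=> x hx; have /andP[x0 _] := hx; split.
      have h := is_derive_lam_comp (dc x) (profile_derive H (cr _ x0) (Sx _ hx)) erefl.
      by apply: (is_derive_lamZ (c := a) h); ring.
    have h := is_derive_lam_comp (dc x) (profile_derive2 H (cr _ x0) (Sx _ hx)) erefl.
    by apply: (is_derive_lamZ (c := a * c) h); ring.
  - move=> x hx; split; last by rewrite divr_gt0// Sx.
    by have := u01 x (W x hx); lra.
  - move=> x /andP[x0 xr]; have hx : 0 <= x <= r by rewrite ltW.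
    have := ode x (W x hx); rewrite sqrrN => <-.
    by rewrite pq; field; rewrite gt_eqF.
  - move=> x /andP[x0 xr]; have hx : 0 <= x <= r by rewrite ltW.
    have Sx0 := Sx _ hx.
    have e := profile_ode H (mulr_gt0 c0 x0) Sx0.
    have -> : Q (c * x) = (1 + delta * P (c * x) ^+ 2) * S (c * x) -
       (N%:R - 1) * (P (c * x) / (c * x)) by rewrite -e; ring.
    by rewrite -ac; field; rewrite !gt_eqF.
  - by rewrite S0 invr1 mulr1.
  - by rewrite mulr0 (profile_derive0 H) mulr0 pq mulr0 oppr0.
(* Where the two agree, u > 0 forces S (c r) > a. Hence S, being continuous, cannot descend to a
   before r = 1, let alone reach 0. *)
have Sgt_pos r : 0 <= r < 1 -> 0 < S (c * r) -> a < S (c * r).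
  move=> hr Sr; have := eqt r hr Sr; have /andP[u0 _] := u01 r hr => e.
  by rewrite -[ltRHS]mul1r -(ltr_pdivrMr _ _ Sr); lra.
have Sgt r : 0 <= r < 1 -> a < S (c * r).
  move=> hr; rewrite ltNge; apply/negP => Sr; have /andP[r0 r1] := hr.
  have [|z /andP[z0 zr] Sz] := @intermediate_value R (fun t => S (c * t)) 0 r a r0
    (fun x _ => cS x).
    by rewrite S0 Sr (ltW a1) orbT.
  have hz : 0 <= z < 1 by rewrite z0 (le_lt_trans zr r1).
  by have := Sgt_pos z hz; rewrite Sz ltxx => /(_ a0).
(* Otherwise a value strictly between S c and a would be taken before r = 1. *)
have Sc : a <= S (c * 1).
  rewrite leNgt; apply/negP => h.
  have [|z /andP[z0 zr] Sz] := @intermediate_value R (fun t => S (c * t)) 0 1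
    ((S (c * 1) + a) / 2) ler01 (fun x _ => cS x).
    by rewrite S0; apply/orP; right; apply/andP; split; lra.
  move: zr; rewrite le_eqVlt => /orP[/eqP zE|z1]; first by move: Sz; rewrite zE; lra.
  have hz : 0 <= z < 1 by rewrite z0.
  have := Sgt z hz; lra.
have Sc0 := lt_le_trans a0 Sc.
have Spos (r : R) : 0 <= r <= 1 -> 0 < S (c * r).
  move=> /andP[r0 r1]; apply: (profile_gt0 H Sc0).
  by rewrite cr// ler_pM2l.
have e1 : 1 - u 1 = a * (S (c * 1))^-1.
  rewrite (@within_continuous_eq_end R u (fun r => 1 - a * (S (c * r))^-1) cu).
  - by rewrite opprB addrC subrK.
  - apply: continuous_segment => r hr; apply: continuous_lamB; first exact: cst_continuous.
    apply: continuous_lamM; first exact: cst_continuous.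
    by apply: continuous_lamV; [exact: cS|rewrite gt_eqF ?Spos].
  - move=> r hr; have := eqt r hr (lt_trans a0 (Sgt r hr)); lra.
have SE : S c = a.
  move: e1; rewrite u1 subr0 mulr1 => e1.
  by rewrite -[RHS](@divfK _ (S c)) -?e1 ?mul1r// -[c]mulr1 gt_eqF.
exists c; rewrite SE; split=> //; first by rewrite mulrC.
move=> y yB; rewrite hU//.
have y1 : enorm y <= 1 := yB.
suff : 1 - u (enorm y) = a * (S (c * enorm y))^-1 by lra.
move: y1; rewrite le_eqVlt => /orP[/eqP->//|y1].
have hy : 0 <= enorm y < 1 by rewrite enorm_ge0.
by apply: eqt => //; apply: lt_trans (Sgt _ hy).
Qed.

(** Solutions for lambda correspond to the rho with rho S(rho) = sqrt lambda, one on each side of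
    the maximum point m. The threshold is the squared maximum, so any admissible rho bounds it from
    below; this is how L enters. *)
Lemma profile_count (R : realType) (N : nat) (delta L : R) (S P Q : R -> R) :
  (2 <= N)%N -> N%:R / 2 <= delta -> ode_profile N delta S P Q ->
  (exists rho, [/\ 0 < rho, 0 < S rho & L <= (rho * S rho) ^+ 2]) ->
  exists lambdabar : R,
    [/\ 0 < lambdabar,
        forall lambda : R, 0 < lambda < lambdabar ->
          exactly_two (@radial_regular_solution R N lambda delta),
        exactly_one (@radial_regular_solution R N lambdabar delta),
        forall lambda : R, lambdabar < lambda ->
          ~ exists U : 'rV[R]_N -> R, radial_regular_solution lambda delta U
      & L <= lambdabar].
Proof.
move=> N2 dN H [rho0 [r00 Sr0 hL]].
have [m m0 [Sm hi hd hsmall]] := profile_ratio_unimodal N2 dN H.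
pose h r := r * S r.
pose sol rho (y : 'rV[R]_N) := 1 - S rho * (S (rho * enorm y))^-1.
have solP rho : 0 < rho -> 0 < S rho ->
    radial_regular_solution ((rho * S rho) ^+ 2) delta (sol rho).
  by move=> r0 Sr; apply: (profile_solution N2 dN H r0 Sr).
have hm rho : 0 < rho -> 0 < S rho -> rho != m -> h rho < h m.
  move=> r0 Sr; rewrite neq_lt => /orP[rm|mr].
    by apply: hi => //; exact: ltW.
  exact: hd.
have hm_le rho : 0 < rho -> 0 < S rho -> h rho <= h m.
  by move=> r0 Sr; have [->//|/(hm _ r0 Sr)/ltW] := eqVneq rho m.
have hm0 : 0 < h m by rewrite mulr_gt0.
have ch (r : R) : {for r, continuous h} by exact: continuous_profile_ratio H.
exists (h m ^+ 2); split.
- by rewrite exprn_gt0.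
- move=> lambda /andP[l0 lm].
  pose e := Num.sqrt lambda.
  have e0 : 0 < e by rewrite sqrtr_gt0.
  have e2 : e ^+ 2 = lambda by rewrite sqr_sqrtr// ltW.
  have em : e < h m by rewrite -ltr_sqr ?nnegrE ?(ltW e0) ?(ltW hm0)// e2.
  have [|r1 /andP[r10 r1m] hr1] := @intermediate_value R h 0 m e (ltW m0) (fun x _ => ch x).
    by rewrite /h mul0r (ltW e0) (ltW em).
  have [b mb hb] := hsmall e e0.
  have [|r2 /andP[mr2 r2b] hr2] := @intermediate_value R h m b e (ltW mb) (fun x _ => ch x).
    by rewrite (ltW em) (ltW hb) orbT.
  have r1p : 0 < r1.
    rewrite lt_neqAle r10 andbT; apply/eqP => z.
    by move: hr1 e0; rewrite /h -z mul0r => <-; rewrite ltxx.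
  have r2p : 0 < r2 by exact: lt_le_trans mr2.
  have Sr1 : 0 < S r1 by move: e0; rewrite -hr1 /h pmulr_rgt0.
  have Sr2 : 0 < S r2 by move: e0; rewrite -hr2 /h pmulr_rgt0.
  exists (sol r1), (sol r2); split.
  + by rewrite -e2 -hr1; exact: solP.
  + by rewrite -e2 -hr2; exact: solP.
  (* Equal values at the origin mean S r1 = S r2; as r1 S(r1) = r2 S(r2), both radii would then
     equal m. *)
  + move=> same.
    have z0 : enorm (0 : 'rV[R]_N) = 0 by apply/eqP; rewrite enorm_eq0.
    have /same : closed_unit_ball (0 : 'rV[R]_N) by rewrite /closed_unit_ball /= z0 ler01.
    rewrite /sol z0 !mulr0 (profile0 H) invr1 !mulr1 => eS.
    have {}eS : S r1 = S r2 by lra.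
    have : r1 = r2.
      by apply: (mulIf (lt0r_neq0 Sr1)); rewrite -/(h r1) hr1 eS -/(h r2) hr2.
    move=> r12; have r1E : r1 = m by apply/eqP; rewrite eq_le r1m r12 mr2.
    by move: em; rewrite -hr1 r1E ltxx.
  + move=> W /(solution_profile (ltnW N2) H l0)[rho [rp Sr hr hW]].
    have {}hr : h rho = e.
      by apply/eqP; rewrite -(@eqrXn2 _ 2)// ?e2 ?hr// ?(ltW e0)// mulr_ge0// ltW.
    have [rm|mr] := leP rho m; [left|right] => y yB; rewrite hW//.
      suff -> : rho = r1 by [].
      have [lt|lt|//] := ltgtP rho r1.
        by have := hi _ _ (ltW rp) lt r1m; rewrite -/(h rho) -/(h r1) hr hr1 ltxx.
      by have := hi _ _ (ltW r1p) lt rm; rewrite -/(h rho) -/(h r1) hr hr1 ltxx.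
    suff -> : rho = r2 by [].
    have [lt|lt|//] := ltgtP rho r2.
      by have := hd _ _ (ltW mr) lt Sr2; rewrite -/(h rho) -/(h r2) hr hr2 ltxx.
    by have := hd _ _ mr2 lt Sr; rewrite -/(h rho) -/(h r2) hr hr2 ltxx.
- exists (sol m); split; first exact: solP.
  have l0 : 0 < h m ^+ 2 by rewrite exprn_gt0.
  move=> W /(solution_profile (ltnW N2) H l0)[rho [rp Sr hr hW]] y yB.
  rewrite hW//; suff -> : rho = m by [].
  apply/eqP/negPn/negP => /(hm _ rp Sr).
  by rewrite -ltr_sqr ?nnegrE ?(ltW hm0) ?mulr_ge0 ?(ltW rp) ?(ltW Sr)// hr ltxx.
- move=> lambda lm [W].
  have l0 : 0 < lambda by apply: lt_trans lm; rewrite exprn_gt0.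
  move=> /(solution_profile (ltnW N2) H l0)[rho [rp Sr hr _]].
  move: lm; rewrite -hr ltr_sqr ?nnegrE ?(ltW hm0) ?mulr_ge0 ?(ltW rp) ?(ltW Sr)//.
  by apply/negP; rewrite -leNgt; exact: hm_le.
- apply: le_trans hL _.
  by rewrite ler_sqr ?nnegrE ?(ltW hm0) ?mulr_ge0 ?(ltW r00) ?(ltW Sr0)//; exact: hm_le.
Qed.

(** * The case delta = N / 2 *)

Definition critical_profile (R : realType) (N : nat) (r : R) : R :=
  (1 + r ^+ 2 / (2 * N%:R))^-1.

Lemma critical_profile_gt0 (R : realType) (N : nat) (r : R) :
  0 < critical_profile N r.
Proof.
by rewrite invr_gt0 ltr_pwDl// divr_ge0 ?sqr_ge0// mulr_ge0// ler0n.
Qed.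

Lemma critical_profile_ode (R : realType) (N : nat) : (0 < N)%N ->
  ode_profile N (N%:R / 2) (@critical_profile R N) (fun r => r / N%:R) (fun=> N%:R^-1).
Proof.
move=> N0; have NR : 0 < N%:R :> R by rewrite ltr0n.
have NR0 : N%:R != 0 :> R by rewrite gt_eqF.
have dT (r : R) : is_derive r 1 (fun t => 1 + t ^+ 2 / (2 * N%:R)) (r / N%:R).
  have h := is_derive_lamM (is_derive_lamX (n := 2%N) (is_derive_lam_id r) erefl)
    (is_derive_lamC (2 * N%:R)^-1 r) erefl.
  by apply: (is_derive_lamD (is_derive_lamC 1 r) h) => /=; field.
have T0 r : 0 < 1 + r ^+ 2 / (2 * N%:R) :> R by rewrite -invr_gt0 critical_profile_gt0.
split.
- move=> r; apply: (@continuous_lamV _ _ (fun t : R => 1 + t ^+ 2 / (2 * N%:R)) r).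
    exact: is_derive_continuous (dT r).
  by rewrite gt_eqF.
- by rewrite /critical_profile expr0n mul0r addr0 invr1.
- by move=> r; rewrite ltW// critical_profile_gt0.
- move=> a b a0 ab; rewrite /critical_profile lef_pV2 ?posrE// lerD2l ler_pM2r.
    by rewrite ler_sqr ?nnegrE// (le_trans a0).
  by rewrite invr_gt0 mulr_gt0.
- move=> r _ _; rewrite /critical_profile.
  have -> : (fun t : R => (1 + t ^+ 2 / (2 * N%:R))^-1^-1) =
    (fun t => 1 + t ^+ 2 / (2 * N%:R)) by apply/funext => t; rewrite invrK.
  exact: dT.
- move=> r _ _; apply: (is_derive_lamM (is_derive_lam_id r) (is_derive_lamC N%:R^-1 r)).
  by rewrite mulr0 addr0 mul1r.
- by move=> r _ _; exact: cst_continuous.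
- by rewrite mul0r.
- by [].
- move=> r r0 _; have := T0 r; rewrite /critical_profile => Tr.
  by field; rewrite NR0 !gt_eqF//=; nra.
Qed.

(** For y = 2 / (delta + 1), ln y <= y - 1 = - (delta - 1) / (delta + 1), so the power is at most 1
    / e <= 1 / 2. *)
Lemma lambda_lower_bound_le (R : realType) (N : nat) (delta : R) :
  1 <= delta -> lambda_lower_bound N delta <= N%:R / 2.
Proof.
move=> d1.
have e2 : expR (- 1) <= 2^-1 :> R.
  rewrite expRN lef_pV2 ?posrE ?expR_gt0//.
  by have := expR_ge1Dx (1 : R); lra.
rewrite /lambda_lower_bound; case: eqVneq => [_|dn1].
  by rewrite ler_wpM2l.
have {dn1}d1 : 1 < delta by rewrite lt_neqAle eq_sym dn1.
have y0 : 0 < 2 / (delta + 1) by rewrite divr_gt0//; lra.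
rewrite ler_wpM2l//; apply: le_trans e2.
rewrite /powR gt_eqF// ler_expR.
have h : ln (2 / (delta + 1)) <= 2 / (delta + 1) - 1.
  have := @le_ln1Dx R (2 / (delta + 1) - 1).
  rewrite [X in ln X]addrC subrK; apply.
  by rewrite ltrBDr addNr.
rewrite mulrC -ler_pdivlMr; last by rewrite divr_gt0//; lra.
apply: le_trans h _; rewrite le_eqVlt; apply/orP; left; apply/eqP.
by field; apply/andP; split; rewrite gt_eqF//; lra.
Qed.
Lemma critical_count_bound (R : realType) (N : nat) : (2 <= N)%N ->
  exists rho : R, [/\ 0 < rho, 0 < critical_profile N rho &
    lambda_lower_bound N (N%:R / 2) <= (rho * critical_profile N rho) ^+ 2].
Proof.
move=> N2; have NR : 2 <= N%:R :> R by rewrite ler_nat.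
(* The maximum point of the explicit ratio: T = 2 there, and the squared ratio is N / 2. *)
exists (Num.sqrt (2 * N%:R)); split.
- by rewrite sqrtr_gt0; lra.
- exact: critical_profile_gt0.
apply: le_trans (@lambda_lower_bound_le R N (N%:R / 2) _) _; first lra.
rewrite /critical_profile exprMn sqr_sqrtr; last lra.
rewrite le_eqVlt; apply/orP; left; apply/eqP.
by field; rewrite gt_eqF//; lra.
Qed.

(** The parameter is alpha = U(0) = 1 - S rho; conversely S rho = 1 - alpha forces rho^2 = 2 N alpha
    / (1 - alpha). *)
Lemma critical_solutions (R : realType) (N : nat) (lambda : R) (U : 'rV[R]_N -> R) :
  (2 <= N)%N -> 0 < lambda ->
  radial_regular_solution lambda (N%:R / 2) U <->
  exists alpha : R,
    [/\ 0 < alpha < 1, lambda = 2 * N%:R * alpha * (1 - alpha)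
      & forall x : 'rV[R]_N, closed_unit_ball x -> U x = alpha * (1 - enorm x ^+ 2)].
Proof.
move=> N2 l0; have H := @critical_profile_ode R N (ltnW N2).
have NR : 0 < N%:R :> R by rewrite ltr0n ltnW.
split.
  move=> /(solution_profile (ltnW N2) H l0)[rho [r0 Sr lE hU]].
  have k0 : 0 < rho ^+ 2 / (2 * N%:R) by rewrite divr_gt0 ?exprn_gt0// mulr_gt0.
  exists (1 - critical_profile N rho); split.
  - rewrite subr_gt0 gtrBl Sr andbT invf_lt1; lra.
  - by rewrite -lE /critical_profile; field; rewrite !gt_eqF//=; nra.
  - move=> x xB; rewrite hU// /critical_profile invrK.
    by field; rewrite !gt_eqF//=; nra.
move=> [al [/andP[a0 a1] lE hU]].
have b0 : 0 < 1 - al by rewrite subr_gt0.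
pose rho := Num.sqrt (2 * N%:R * al / (1 - al)).
have k0 : 0 < 2 * N%:R * al / (1 - al) by rewrite divr_gt0// !mulr_gt0.
have r2 : rho ^+ 2 = 2 * N%:R * al / (1 - al) by rewrite sqr_sqrtr// ltW.
have r0 : 0 < rho by rewrite sqrtr_gt0.
have SE : critical_profile N rho = 1 - al.
  by rewrite /critical_profile r2; field; rewrite !gt_eqF//=; nra.
have -> : lambda = (rho * critical_profile N rho) ^+ 2.
  by rewrite SE exprMn r2 lE; field; rewrite gt_eqF.
apply: (profile_solution N2 (lexx _) H r0 (critical_profile_gt0 N rho)).
move=> y yB; rewrite hU// SE /critical_profile invrK exprMn r2.
by field; rewrite !gt_eqF.
Qed.

(** * The radial Poisson equation *)

(* v'' + (N - 1) v' / r = f with m = v'; at r = 0 the equation reads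
   m' 0 = f 0 / N. *)
Definition radial_primitive (R : realType) (N : nat) (f v m : R -> R) : Prop :=
  [/\ v 0 = 0, m 0 = 0, forall r : R, 0 <= r -> is_derive r 1 v (m r),
      is_derive (0 : R) 1 m (f 0 / N%:R)
    & forall r : R, 0 < r -> is_derive r 1 m (f r - (N%:R - 1) * (m r / r))].

Lemma continuous_abs0 (R : realType) (f : R -> R) :
  (forall e, 0 < e -> exists2 d, 0 < d & forall r, 0 < r < d -> `|f r - f 0| < e) ->
  {for 0, continuous (fun t : R => f `|t|)}.
Proof.
move=> h; apply/continuous_dist => e e0; have [d d0 hd] := h e e0.
exists d => // y; rewrite subr0 normr0 => yd.
have [->|y0] := eqVneq y 0; first by rewrite normr0 subrr normr0.
by apply: hd; rewrite normr_gt0 y0.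
Qed.

(** The equation is (r^n m)' = r^n f, so m = I / r^n with I the integral of r^n f. The work lies at
    0, where q = m / r must tend to f 0 / N. *)
Lemma radial_primitive_exists (R : realType) (n : nat) (f : R -> R) :
  continuous f -> exists vm : (R -> R) * (R -> R), radial_primitive n.+1 f vm.1 vm.2.
Proof.
move=> cf.
have n0 : 0 < n.+1%:R :> R by rewrite ltr0n.
have cI : continuous (fun s : R => s ^+ n * f s).
  move=> s; apply: (@continuous_lamM _ _ (fun t : R => t ^+ n) f s); last exact: cf.
  exact: exprn_continuous.
have [I I0 dI] := antiderivative cI.
pose q (r : R) := if r == 0 then f 0 / n.+1%:R else I r / r ^+ n.+1.
(* The odd extension makes m continuous on the whole line, so it has an antiderivative, and makes
   its derivative at 0 two-sided. *)
pose m (r : R) := r * q `|r|.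
have qE r : 0 < r -> q r = I r / r ^+ n.+1 by move=> r0; rewrite /q gt_eqF.
have dX (r : R) : is_derive r 1 (fun t => t ^+ n.+1) (n.+1%:R * r ^+ n).
  by apply: (is_derive_lamX (n := n.+1) (is_derive_lam_id r)); rewrite mulr1.
have dq (r : R) : 0 < r -> is_derive r 1 (fun t => q `|t|)
    (f r / r - n.+1%:R * (I r / r ^+ n.+2)).
  move=> r0; have rX : r ^+ n.+1 != 0 by rewrite expf_neq0// gt_eqF.
  have h := is_derive_lamM (dI r (ltW r0)) (is_derive_lamV (dX r) rX erefl) erefl.
  apply: (@is_derive_near _ (fun t => I t / t ^+ n.+1)).
    exists r => // t; rewrite ltr_distl subrr => /andP[t0 _].
    by rewrite gtr0_norm// qE.
  by apply: (is_derive_eq h); rewrite !exprS; field; rewrite expf_neq0 gt_eqF.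
have cq0 : {for 0, continuous (fun t : R => q `|t|)}.
  apply: continuous_abs0 => e e0.
  have /continuous_dist /(_ (e / 2))[|d d0 hd] := cf 0; first by rewrite divr_gt0.
  exists d => // r /andP[r0 rd].
  have q0 : q 0 = f 0 / n.+1%:R by rewrite /q eqxx.
  (* The two signs together say |N I - f(0) r^N| <= (e / 2) r^N; each F is nondecreasing because f
     stays within e / 2 of f 0. *)
  have hle (sg : R) : sg = 1 \/ sg = -1 ->
      0 <= e / 2 * r ^+ n.+1 + sg * (n.+1%:R * I r - f 0 * r ^+ n.+1).
    move=> hsg.
    pose F (t : R) := e / 2 * t ^+ n.+1 + sg * (n.+1%:R * I t - f 0 * t ^+ n.+1).
    have dF (t : R) : 0 <= t -> is_derive t 1 F
        (n.+1%:R * t ^+ n * (e / 2 + sg * (f t - f 0))).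
      move=> t0.
      have h1 := is_derive_lamB (is_derive_lamZ (c := n.+1%:R) (dI t t0) erefl)
        (is_derive_lamZ (c := f 0) (dX t) erefl) erefl.
      apply: (is_derive_lamD (is_derive_lamZ (c := e / 2) (dX t) erefl)
        (is_derive_lamZ (c := sg) h1 erefl)).
      by ring.
    have : F 0 <= F r.
      apply: (derive_ge0_le (ltW r0)
        (df := fun t => n.+1%:R * t ^+ n * (e / 2 + sg * (f t - f 0)))).
      - by move=> t /andP[t0 _]; apply: dF; exact: ltW.
      - move=> t /andP[t0 tr]; rewrite mulr_ge0//.
          by rewrite mulr_ge0 ?(ltW n0)// exprn_ge0// ltW.
        have /hd : `|t - 0| < d by rewrite subr0 gtr0_norm// (lt_trans tr).
        by rewrite ltr_distl => /andP[h1 h2]; case: hsg => ->; lra.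
      - apply: continuous_segment => t /andP[t0 _]; exact: is_derive_continuous (dF t t0).
    by rewrite {1}/F I0 expr0n /= !mulr0 subrr mulr0 addr0.
  have rX : 0 < r ^+ n.+1 by rewrite exprn_gt0.
  have h1 := hle 1 (or_introl erefl); have h2 := hle (-1) (or_intror erefl).
  rewrite qE// q0.
  have -> : I r / r ^+ n.+1 - f 0 / n.+1%:R =
    (n.+1%:R * I r - f 0 * r ^+ n.+1) / (n.+1%:R * r ^+ n.+1).
    by field; rewrite !gt_eqF.
  rewrite normrM normfV [`|n.+1%:R * _|]gtr0_norm ?mulr_gt0// ltr_pdivrMr ?mulr_gt0//.
  apply: (@le_lt_trans _ _ (e / 2 * r ^+ n.+1)).
    by rewrite ler_norml; apply/andP; split; lra.
  have : r ^+ n.+1 <= n.+1%:R * r ^+ n.+1 by rewrite ler_peMl ?ler1n// ltW.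
  have : e * r ^+ n.+1 > 0 by rewrite mulr_gt0.
  nra.
have cm : continuous m.
  move=> r; apply: (@continuous_lamM _ _ (fun t : R => t) (fun t => q `|t|) r).
    exact: is_derive_continuous (is_derive_lam_id r).
  have [r0|r0|->//] := ltgtP r 0; last exact: is_derive_continuous (dq r r0).
  have -> : (fun t : R => q `|t|) = (fun t : R => q `|- t|).
    by apply/funext => t; rewrite normrN.
  apply: (@continuous_comp _ _ _ (fun t : R => - t) (fun t => q `|t|)).
    exact: (is_derive_continuous (is_derive_lamN (is_derive_lam_id r) erefl)).
  by apply: is_derive_continuous (dq _ _); rewrite oppr_gt0.
have [v v0 dv] := antiderivative cm.
exists (v, m); split => //=.
- by rewrite /m mul0r.
- apply/is_derive1_caratheodory; exists (fun t => q `|t|); split => //.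
    by move=> z; rewrite /m mul0r !subr0 mulrC.
  by rewrite normr0 /q eqxx.
- move=> r r0; apply: (is_derive_lamM (is_derive_lam_id r) (dq r r0)).
  rewrite /m gtr0_norm// qE// -natr1 !exprS; field.
  by rewrite expf_neq0 gt_eqF.
Qed.

Lemma radial_primitive_lin (R : realType) (N : nat) (c d : R) (f v m g w k : R -> R) :
  radial_primitive N f v m -> radial_primitive N g w k ->
  radial_primitive N (fun r => c * f r + d * g r) (fun r => c * v r + d * w r)
    (fun r => c * m r + d * k r).
Proof.
move=> [v0 m0 dv dm0 dm] [w0 k0 dw dk0 dk].
have lin (f1 f2 : R -> R) (r a b : R) : is_derive r 1 f1 a -> is_derive r 1 f2 b ->
    is_derive r 1 (fun t => c * f1 t + d * f2 t) (c * a + d * b).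
  by move=> h1 h2; exact: is_derive_lamD (is_derive_lamZ h1 erefl) (is_derive_lamZ h2 erefl) erefl.
split.
- by rewrite v0 w0 !mulr0 addr0.
- by rewrite m0 k0 !mulr0 addr0.
- by move=> r r0; exact: lin (dv r r0) (dw r r0).
- by apply: (is_derive_eq (lin _ _ _ _ _ dm0 dk0)); ring.
- by move=> r r0; apply: (is_derive_eq (lin _ _ _ _ _ (dm r r0) (dk r r0))); ring.
Qed.

(** A comparison principle from (r^n m)' = r^n f <= 0; with linearity it yields all later bounds on
    v. *)
Lemma radial_primitive_le0 (R : realType) (n : nat) (f v m : R -> R) (r : R) :
  radial_primitive n.+1 f v m -> (forall s, 0 < s -> f s <= 0) -> 0 <= r ->
  m r <= 0 /\ v r <= 0.
Proof.
move=> [v0 m0 dv dm0 dm] f0.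
have m_le0 s : 0 <= s -> m s <= 0.
  rewrite le_eqVlt => /orP[/eqP<-|s0]; first by rewrite m0.
  have dM (t : R) : 0 < t -> is_derive t 1 (fun t => t ^+ n * m t) (t ^+ n * f t).
    move=> t0; have h := is_derive_lamX (n := n) (is_derive_lam_id t) erefl.
    apply: (is_derive_lamM h (dm t t0)); rewrite -natr1.
    case: n {f0 dm0 dm dv h} => [|k] /=; first by rewrite !mul0r expr0; ring.
    by rewrite exprS; field; rewrite gt_eqF.
  have : s ^+ n * m s <= 0 ^+ n * m 0.
    apply: (@derive_le0_ge R (fun t => t ^+ n * m t) (fun t => t ^+ n * f t) 0 s (ltW s0)).
    - by move=> t /andP[t0 _]; exact: dM.
    - move=> t /andP[t0 _]; by rewrite mulr_ge0_le0 ?f0 ?exprn_ge0 ?(ltW t0).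
    - apply: continuous_segment => t /andP[]; rewrite le_eqVlt => /orP[/eqP<- _|t0 _].
        apply: continuous_lamM; first exact: exprn_continuous.
        exact: is_derive_continuous dm0.
      exact: is_derive_continuous (dM t t0).
  by rewrite m0 mulr0 pmulr_rle0// exprn_gt0.
move=> r0; split; first exact: m_le0.
rewrite -v0; apply: (derive_le0_ge r0 (df := m)).
- by move=> s /andP[s0 _]; apply: dv; exact: ltW.
- by move=> s /andP[s0 _]; apply: m_le0; exact: ltW.
- by apply: continuous_segment => s /andP[s0 _]; exact: is_derive_continuous (dv s s0).
Qed.

(** Barrier for the weighted norm: the radial Laplacian of exp (c r^2) is at least 2 c N exp (c
    r^2). *)
Lemma gauss_radial_primitive (R : realType) (n : nat) (c : R) :
  radial_primitive n.+1
    (fun r => (2 * c * n.+1%:R + 4 * c ^+ 2 * r ^+ 2) * expR (c * r ^+ 2))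
    (fun r => expR (c * r ^+ 2) - 1) (fun r => 2 * c * r * expR (c * r ^+ 2)).
Proof.
have dE (r : R) : is_derive r 1 (fun t => expR (c * t ^+ 2))
    (2 * c * r * expR (c * r ^+ 2)).
  have h := is_derive_lamZ (c := c) (is_derive_lamX (n := 2%N) (is_derive_lam_id r) erefl) erefl.
  by apply: (is_derive_lam_comp h (is_derive_expR _)) => /=; ring.
have dM (r : R) : is_derive r 1 (fun t => 2 * c * t * expR (c * t ^+ 2))
    ((2 * c + 4 * c ^+ 2 * r ^+ 2) * expR (c * r ^+ 2)).
  have h := is_derive_lamZ (c := 2 * c) (is_derive_lam_id r) erefl.
  by apply: (is_derive_lamM h (dE r)); ring.
split.
- by rewrite expr0n mulr0 expR0 subrr.
- by rewrite mulr0 mul0r.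
- move=> r _; apply: (is_derive_lamB (dE r) (is_derive_lamC 1 r)).
  by rewrite subr0.
- apply: (is_derive_eq (dM 0)); rewrite expr0n !mulr0 !addr0.
  have : n.+1%:R != 0 :> R by rewrite pnatr_eq0.
  by move: (n.+1%:R : R) => k k0; field.
- by move=> r r0; apply: (is_derive_eq (dM r)); field; rewrite gt_eqF.
Qed.

(** Comparison of v and - v with a multiple of the Gaussian barrier: inverting the radial Laplacian
    gains the factor 1 / (2 c N) in the weighted norm. *)
Lemma radial_primitive_gauss_bound (R : realType) (n : nat) (c M : R) (f v m : R -> R) (r : R) :
  0 < c -> radial_primitive n.+1 f v m ->
  (forall s, 0 < s -> `|f s| <= M * expR (c * s ^+ 2)) -> 0 <= r ->
  `|v r| <= M / (2 * c * n.+1%:R) * expR (c * r ^+ 2).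
Proof.
move=> c0 H fM r0.
have n0 : 0 < n.+1%:R :> R by rewrite ltr0n.
have k0 : 0 < 2 * c * n.+1%:R by rewrite !mulr_gt0.
have M0 : 0 <= M.
  have := le_trans (normr_ge0 _) (fM 1 ltr01).
  by rewrite pmulr_lge0// expR_gt0.
pose K := M / (2 * c * n.+1%:R).
have K0 : 0 <= K by rewrite divr_ge0// ltW.
have hb (sg : R) : sg = 1 \/ sg = -1 -> sg * v r <= K * expR (c * r ^+ 2).
  move=> hsg.
  have := radial_primitive_lin sg (- K) H (gauss_radial_primitive n c).
  move=> /radial_primitive_le0 /(_ _ r0)[].
    move=> s s0; rewrite mulNr subr_le0.
    apply: (@le_trans _ _ `|f s|).
      by case: hsg => ->; rewrite ?mul1r ?mulN1r ?ler_norm// -normrN ler_norm.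
    apply: le_trans (fM s s0) _.
    rewrite [leRHS]mulrA ler_pM2r ?expR_gt0// mulrDr /K divfK ?gt_eqF//.
    by rewrite lerDl mulr_ge0// mulr_ge0 ?sqr_ge0// mulr_ge0 ?sqr_ge0.
  move=> _ h; move: h; rewrite mulrBr mulr1 !mulNr; lra.
apply/ler_normlP; split.
  by rewrite -mulN1r; apply: hb; right.
by rewrite -[v r]mul1r; apply: hb; left.
Qed.

Lemma half_power_small (R : realType) (C e : R) :
  0 < e -> exists n : nat, C * 2^-1 ^+ n < e.
Proof.
move=> e0; pose n := Num.bound `|C / e|; exists n.
have h : C / e < 2 ^+ n.
  apply: le_lt_trans (ler_norm _) _.
  apply: lt_trans (archi_boundP (normr_ge0 _)) _.
  by rewrite -natrX ltr_nat ltn_expl.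
by rewrite exprVn ltr_pdivrMr ?exprn_gt0// mulrC -ltr_pdivrMr.
Qed.

Lemma continuous_radial_primitive (R : realType) (N : nat) (f v m : R -> R) :
  radial_primitive N f v m -> continuous (fun r : R => v `|r|).
Proof.
move=> [_ _ dv _ _] r.
apply: (@continuous_comp _ _ _ (fun t : R => `|t|) v r).
  exact: norm_continuous.
exact: is_derive_continuous (dv _ (normr_ge0 r)).
Qed.

(* Picard iteration; in the norm weighted by expR (L r^2) the iteration map is
   a contraction of ratio 1/2 on the whole half-line. *)
Lemma radial_picard (R : realType) (n : nat) (L : R) (F : R -> R) :
  0 < L -> (forall x y, `|F x - F y| <= L * `|x - y|) ->
  exists v m : R -> R, radial_primitive n.+1 (fun r => F (v `|r|)) v m.
Proof.
move=> L0 FL.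
have n1 : 1 <= n.+1%:R :> R by rewrite ler1n.
have n0 : 0 < n.+1%:R :> R by exact: lt_le_trans n1.
(* With c = L the gain 1 / (2 c N) times the Lipschitz constant L is at most 1 / 2. *)
pose c := L; pose w (r : R) := expR (c * r ^+ 2).
have w0 r : 0 < w r by exact: expR_gt0.
have k0 : 0 < 2 * c * n.+1%:R by rewrite !mulr_gt0.
have Lk : L / (2 * c * n.+1%:R) <= 2^-1.
  rewrite ler_pdivrMr// /c.
  have : L <= L * n.+1%:R by rewrite ler_peMr// ltW.
  lra.
have cF : continuous F.
  move=> x; apply/(continuous_dist F) => e e0; exists (e / L); first by rewrite divr_gt0.
  move=> y; rewrite ltr_pdivlMr// mulrC; exact: le_lt_trans (FL y x).
have /choice[A hA] (f : R -> R) : exists vm : (R -> R) * (R -> R),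
    continuous f -> radial_primitive n.+1 f vm.1 vm.2.
  (* Discontinuous f receive the default (f, f), as [choice] needs a value for every f. *)
  have [cf|ncf] := pselect (continuous f); last by exists (f, f).
  by have [vm h] := radial_primitive_exists n cf; exists vm.
pose next (v : R -> R) := (A (fun r => F (v `|r|))).1.
pose V k := iter k next (fun=> 0).
have cV k : continuous (fun r : R => F (V k `|r|)) /\ continuous (fun r : R => V k `|r|).
  elim: k => [|k [IH _]].
    by split=> x; exact: cst_continuous.
  have h := continuous_radial_primitive (hA _ IH).
  split=> // x.
  exact: (@continuous_comp _ _ _ (fun r : R => V k.+1 `|r|) F x (h x) (cF _)).
have HV k : radial_primitive n.+1 (fun r => F (V k `|r|)) (V k.+1)
   (A (fun r => F (V k `|r|))).2.
  by have [h _] := cV k; exact: hA.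
have diff (f g v1 m1 v2 m2 : R -> R) (K r : R) :
    radial_primitive n.+1 f v1 m1 -> radial_primitive n.+1 g v2 m2 -> 0 <= K ->
    (forall s, 0 < s -> `|f s - g s| <= L * (K * w s)) -> 0 <= r ->
    `|v1 r - v2 r| <= K / 2 * w r.
  move=> h1 h2 K0 hfg r0.
  have := radial_primitive_lin 1 (- 1) h1 h2.
  move=> h12; have hb := @radial_primitive_gauss_bound R n c (L * K) _ _ _ r L0 h12.
  move: hb; rewrite mul1r mulN1r => hb; apply: le_trans (hb _ r0) _.
    by move=> s s0; rewrite mul1r mulN1r -mulrA; exact: hfg.
  rewrite -/(w r) ler_pM2r// mulrAC [K / 2]mulrC.
  by rewrite ler_wpM2r.
pose D := `|F 0| / L.
have D0 : 0 <= D by rewrite divr_ge0// ltW.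
have step k : forall r, 0 <= r -> `|V k.+1 r - V k r| <= D * 2^-1 ^+ k * w r.
  elim: k => [|k IH] r r0.
    rewrite subr0 expr0 mulr1.
    have := @radial_primitive_gauss_bound R n c `|F 0| _ _ _ r L0 (HV 0%N).
    move=> hb; apply: le_trans (hb _ r0) _.
      move=> s s0 /=; rewrite ler_peMr// -expR0 ler_expR mulr_ge0 ?sqr_ge0//; exact: ltW.
    rewrite -/(w r) ler_pM2r// /D ler_wpM2l// lef_pV2 ?posrE//.
    have : L <= L * n.+1%:R by rewrite ler_peMr// ltW.
    rewrite /c; lra.
  have K0 : 0 <= D * 2^-1 ^+ k by rewrite mulr_ge0// exprn_ge0.
  have := diff _ _ _ _ _ _ _ r (HV k.+1) (HV k) K0.
  rewrite exprSr mulrA; apply=> // s s0.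
  apply: le_trans (FL _ _) _; rewrite ler_pM2l// (gtr0_norm s0).
  by apply: IH; exact: ltW.
(* The margin is the geometric tail of the step bounds, so the intervals [lo, hi] are nested; their
   common point v comes with an explicit rate. *)
pose hi k r := V k r + 2 * D * w r * 2^-1 ^+ k.
pose lo k r := V k r - 2 * D * w r * 2^-1 ^+ k.
have hiS k r : 0 <= r -> hi k.+1 r <= hi k r /\ lo k r <= lo k.+1 r.
  move=> r0; have := step k r r0; rewrite ler_norml => /andP[h1 h2].
  rewrite /hi /lo exprSr; lra.
have gap k r : 0 <= 2 * D * w r * 2^-1 ^+ k.
  by apply: mulr_ge0; [apply: mulr_ge0; [apply: mulr_ge0|exact: ltW]|exact: exprn_ge0].
have himono k j r : 0 <= r -> hi (k + j)%N r <= hi k r /\ lo k r <= lo (k + j)%N r.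
  move=> r0; elim: j => [|j [IH1 IH2]]; first by rewrite addn0.
  have [h1 h2] := hiS (k + j)%N r r0; rewrite addnS; split.
    exact: le_trans IH1.
  exact: le_trans h2.
have lohi k j r : 0 <= r -> lo k r <= hi j r.
  move=> r0; have [_ h1] := himono k j r r0; have [h2 _] := himono j k r r0.
  apply: (le_trans h1); rewrite addnC; apply: le_trans h2.
  rewrite /lo /hi lerD2l; apply: (@le_trans _ _ 0); last exact: gap.
  by rewrite oppr_le0; exact: gap.
pose v r := sup (range (fun k => lo k r)).
have vb k r : 0 <= r -> `|V k r - v r| <= 2 * D * w r * 2^-1 ^+ k.
  move=> r0.
  have ub j : ubound (range (fun k => lo k r)) (hi j r).
    by move=> _ [i _ <-]; exact: lohi.
  have h1 : lo k r <= v r.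
    by apply: ub_le_sup; [exists (hi 0%N r); exact: ub|exists k].
  have h2 : v r <= hi k r.
    by apply: ge_sup; [exists (lo 0%N r); exists 0%N|exact: ub].
  by rewrite ler_norml; move: h1 h2; rewrite /lo /hi; lra.
have cv : continuous (fun r : R => v `|r|).
  move=> x; apply/(continuous_dist (fun r : R => v `|r|)) => e e0.
  (* W bounds the weight on the unit neighbourhood of x, making the convergence uniform there. *)
  pose W := w (`|x| + 1).
  have [k hk] := @half_power_small R (2 * D * W) (e / 4) (divr_gt0 e0 (ltr0Sn _ 3)).
  have [_ /(_ x)/(continuous_dist (fun r : R => V k `|r|)) /(_ (e / 4))] := cV k.
  rewrite divr_gt0// => /(_ isT)[d d0 hd].
  exists (Num.min d 1); first by rewrite lt_min d0 ltr01.
  move=> y; rewrite lt_min => /andP[yd y1].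
  have near_bound z : `|z - x| < 1 -> `|V k `|z| - v `|z| | < e / 4.
    move=> z1; apply: le_lt_trans (vb k _ (normr_ge0 z)) _.
    have D2 : 0 <= 2 * D by exact: mulr_ge0.
    apply: le_lt_trans hk; rewrite ler_wpM2r ?exprn_ge0// ler_wpM2l//.
    rewrite /W /w ler_expR ler_pM2l//.
    have : `|z| <= `|x| + 1.
      have := ler_normD x (z - x); rewrite addrC subrK; lra.
    by move=> hz; rewrite ler_sqr ?nnegrE ?addr_ge0.
  have := near_bound y y1.
  have : `|V k `|x| - v `|x| | < e / 4 by apply: near_bound; rewrite subrr normr0.
  have := hd y yd.
  move: (V k `|x|) (V k `|y|) (v `|x|) (v `|y|) => a1 a2 a3 a4; clear.
  by rewrite !ltr_norml => /andP[? ?] /andP[? ?] /andP[? ?]; apply/andP; split; lra.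
have cFv : continuous (fun r : R => F (v `|r|)).
  by move=> x; exact: (@continuous_comp _ _ _ (fun r : R => v `|r|) F x (cv x) (cF _)).
have Hv := hA _ cFv.
set v' := (A _).1 in Hv; set m' := (A _).2 in Hv.
(* The limit is a fixed point: v' and v both lie within D 2^-k w of the iterate k + 1, for every
   k. *)
have vv' r : 0 <= r -> v' r = v r.
  move=> r0; apply/eqP; rewrite -subr_eq0 -normr_eq0 eq_le normr_ge0 andbT leNgt.
  apply/negP => e0.
  have [k hk] := @half_power_small R (2 * D * w r) _ e0.
  have K0 : 0 <= 2 * D * 2^-1 ^+ k.
    by apply: mulr_ge0; [exact: mulr_ge0|exact: exprn_ge0].
  have := diff _ _ _ _ _ _ _ r Hv (HV k) K0.
  have hfg s : 0 < s -> `|F (v `|s|) - F (V k `|s|)| <= L * (2 * D * 2^-1 ^+ k * w s).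
    move=> s0; apply: le_trans (FL _ _) _; rewrite ler_pM2l// (gtr0_norm s0) distrC.
    by apply: le_trans (vb k s (ltW s0)) _; rewrite mulrAC.
  move=> /(_ hfg r0) h1.
  have := vb k.+1 r r0; rewrite exprSr => h2.
  have := ler_normD (v' r - V k.+1 r) (V k.+1 r - v r).
  rewrite addrA subrK; lra.
exists v', m'.
have -> : (fun r : R => F (v' `|r|)) = (fun r : R => F (v `|r|)) => //.
by apply/funext => r; rewrite vv'.
Qed.

(** * The case delta > N / 2 *)

(* Powers are taken of truncated numbers because [powR] has the junk value 1 at
   negative arguments. *)
Definition clip (R : realType) (x : R) : R := Num.min (Num.max x 0) 1.

Lemma clip_ge0 (R : realType) (x : R) : 0 <= clip x.
Proof. by rewrite le_min le_max lexx orbT ler01. Qed.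

Lemma clip_le1 (R : realType) (x : R) : clip x <= 1.
Proof. by rewrite ge_min lexx orbT. Qed.

Lemma clip_id (R : realType) (x : R) : 0 <= x <= 1 -> clip x = x.
Proof. by move=> /andP[x0 x1]; rewrite /clip (max_idPl x0) (min_idPl x1). Qed.

Lemma clip_lipschitz (R : realType) (x y : R) : `|clip x - clip y| <= `|x - y|.
Proof.
have clipE z : clip z = if z <= 0 then 0 else if z <= 1 then z else 1 :> R.
  by rewrite /clip; case: (leP z 0) => _; [rewrite (min_idPl ler01)|case: leP].
rewrite !clipE; have [h1 h2] := ler_normlP _ _ (lexx `|x - y|).
apply/ler_normlP.
by case: (leP x 0); case: (leP y 0); case: (leP x 1); case: (leP y 1) => *; split; lra.
Qed.

(** The mean value theorem with derivative p c^(p - 1) <= p on (0, 1]; for y = 0 it is replaced by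
    x^p <= x <= p x. *)
Lemma powR_lipschitz01 (R : realType) (p x y : R) :
  1 <= p -> 0 <= y -> y <= x -> x <= 1 -> 0 <= x `^ p - y `^ p <= p * (x - y).
Proof.
move=> p1 y0; rewrite le_eqVlt => /orP[/eqP-> _|yx x1].
  by rewrite !subrr mulr0 lexx.
have x0 : 0 < x by exact: le_lt_trans yx.
have p0 : 0 < p by exact: lt_le_trans p1.
apply/andP; split.
  by rewrite subr_ge0 ge0_ler_powR ?nnegrE ?(ltW p0) ?(ltW x0)// ltW.
move: y0; rewrite le_eqVlt => /orP[/eqP<-|y0].
  rewrite powR0 ?gt_eqF// !subr0; apply: (@le_trans _ _ x).
    by apply: ge1r_powR => //; rewrite x0.
  by rewrite ler_peMl// ltW.
have dp (t : R) : y <= t -> is_derive t 1 (fun t => t `^ p) (p * t `^ (p - 1)).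
  by move=> yt; apply: is_derive1_powR; exact: lt_le_trans yt.
have cp : {within `[y, x], continuous (fun t => t `^ p)}.
  by apply: continuous_segment => t /andP[yt _]; exact: is_derive_continuous (dp t yt).
have dp' (t : R) : y < t < x -> is_derive t 1 (fun t => t `^ p) (p * t `^ (p - 1)).
  by move=> /andP[yt _]; apply: dp; exact: ltW.
have [c /andP[yc cx] ->] := mean_value yx dp' cp.
rewrite ler_wpM2r ?subr_ge0 ?(ltW yx)// ler_piMr ?(ltW p0)//.
have h1 : 1 `^ (p - 1) = 1 :> R by rewrite powR1.
rewrite -[leRHS]h1; apply: ge0_ler_powR; rewrite ?nnegrE ?subr_ge0//.
- by rewrite ltW// (lt_trans y0).
- by rewrite ltW// (lt_le_trans cx).
Qed.

Lemma powR_clip_lipschitz (R : realType) (p x y : R) : 1 <= p ->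
  `|clip x `^ p - clip y `^ p| <= p * `|x - y|.
Proof.
move=> p1; apply: (@le_trans _ _ (p * `|clip x - clip y|)); last first.
  by rewrite ler_wpM2l ?clip_lipschitz//; exact: le_trans p1.
wlog yx : x y / clip y <= clip x.
  move=> h; have [/h//|/ltW/h] := leP (clip y) (clip x).
  by rewrite distrC [in leRHS]distrC.
have /andP[h1 h2] := powR_lipschitz01 p1 (clip_ge0 y) yx (clip_le1 x).
by rewrite !ger0_norm// subr_ge0.
Qed.

Lemma const_radial_primitive (R : realType) (n : nat) (K : R) :
  radial_primitive n.+1 (fun=> K) (fun r => K / (2 * n.+1%:R) * r ^+ 2)
    (fun r => K / n.+1%:R * r).
Proof.
have n0 : n.+1%:R != 0 :> R by rewrite pnatr_eq0.
have dm (r : R) : is_derive r 1 (fun t => K / n.+1%:R * t) (K / n.+1%:R).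
  by apply: (is_derive_lamZ (is_derive_lam_id r)); rewrite mulr1.
split=> [|| r _||r r0].
- by rewrite expr0n mulr0.
- by rewrite mulr0.
- apply: (is_derive_lamZ (is_derive_lamX (n := 2%N) (is_derive_lam_id r) erefl)) => /=.
  by move: (n.+1%:R : R) n0 => k k0; field.
- exact: dm.
- apply: (is_derive_eq (dm r)).
  by move: (n.+1%:R : R) n0 => k k0; field; rewrite k0 gt_eqF.
Qed.

(** Gives continuity of S where it reaches 0. The exponent may be below 1 there, so the modulus is
    e^(1 / a) instead of a Lipschitz bound. *)
Lemma powR_max0_continuous (R : realType) (a x : R) : 0 < a ->
  {for x, continuous (fun t : R => Num.max t 0 `^ a)}.
Proof.
move=> a0; have [x0|x0] := ltP 0 x.
  apply: near_continuous (is_derive_continuous (is_derive1_powR a x0)).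
  by near=> t; rewrite (max_idPl _)// ltW//; near: t; exact: lt_nbhsr.
apply/continuous_dist => e e0; rewrite (max_idPr x0) powR0 ?gt_eqF//.
exists (e `^ a^-1); first exact: powR_gt0.
move=> y yx; rewrite subr0 ger0_norm ?powR_ge0//.
have h : Num.max y 0 < e `^ a^-1.
  rewrite gt_max powR_gt0// andbT.
  by apply: le_lt_trans yx; rewrite ler_normr; apply/orP; left; lra.
apply: (@lt_le_trans _ _ ((e `^ a^-1) `^ a)).
  by apply: gt0_ltr_powR; rewrite ?nnegrE ?powR_ge0// le_max lexx orbT.
by rewrite -powRrM mulVf ?gt_eqF// powRr1 ?(ltW e0).
Unshelve. all: by end_near. Qed.

(** Since (delta + 1) / (delta - 1) = 1 + 2 / (delta - 1), the bound has the form rho^2 s^2 with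
    rho^2 = 2 N / (delta + 1). *)
Lemma lambda_lower_boundE (R : realType) (N : nat) (delta : R) : 1 < delta ->
  lambda_lower_bound N delta =
  2 * N%:R / (delta + 1) * ((2 / (delta + 1)) `^ (delta - 1)^-1) ^+ 2.
Proof.
move=> d1; rewrite /lambda_lower_bound gt_eqF//.
have y0 : 0 < 2 / (delta + 1) by rewrite divr_gt0//; lra.
set y := 2 / (delta + 1) in y0 *; set b := (delta - 1)^-1.
have -> : (delta + 1) / (delta - 1) = 1 + (b + b).
  by rewrite /b; field; rewrite gt_eqF//; lra.
have yn : y != 0 by rewrite gt_eqF.
rewrite !powRD ?yn ?implybT// powRr1 ?(ltW y0)// /y expr2.
by ring.
Qed.

Lemma supercritical_profile (R : realType) (N : nat) (delta : R) :
  (0 < N)%N -> 1 < delta ->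
  exists S P Q : R -> R, ode_profile N delta S P Q /\
    exists rho, [/\ 0 < rho, 0 < S rho &
      lambda_lower_bound N delta <= (rho * S rho) ^+ 2].
Proof.
case: N => // n _ d1.
have n0 : 0 < n.+1%:R :> R by rewrite ltr0n.
pose b : R := (delta - 1)^-1; pose p : R := 1 + (b + b).
have dd0 : 0 < delta - 1 by lra.
have b0 : 0 < b by rewrite invr_gt0.
have p1 : 1 <= p by rewrite /p; lra.
have dE : delta = 1 + b^-1 by rewrite /b invrK; lra.
(* The unknown is v = 1 - w, so that v 0 = 0. Clipping makes F globally Lipschitz and changes
   nothing where S > 0, since 0 < w <= 1 there. *)
pose F (x : R) := (delta - 1) * clip (1 - x) `^ p.
have FL x y : `|F x - F y| <= (delta - 1) * p * `|x - y|.
  rewrite /F -mulrBr normrM (gtr0_norm dd0) -mulrA ler_pM2l//.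
  apply: le_trans (powR_clip_lipschitz _ _ p1) _.
  have -> : 1 - x - (1 - y) = y - x by ring.
  by rewrite distrC.
have L0 : 0 < (delta - 1) * p by rewrite mulr_gt0// (lt_le_trans _ p1).
have [v [m H]] := radial_picard n L0 FL.
pose phi (r : R) := F (v `|r|); pose w r := 1 - v r.
have [v0 m0 dv dm0 dm] := H.
have phi_ge0 r : 0 <= phi r by rewrite mulr_ge0 ?powR_ge0// ltW.
have phi_le r : phi r <= delta - 1.
  rewrite /phi /F ler_piMr ?(ltW dd0)//.
  have h1 : 1 `^ p = 1 :> R by rewrite powR1.
  by rewrite -[leRHS]h1; apply: ge0_ler_powR; rewrite ?nnegrE ?clip_ge0 ?clip_le1// (le_trans _ p1).
have mv_ge0 r : 0 <= r -> 0 <= m r /\ 0 <= v r.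
  move=> r0; have := radial_primitive_le0 (radial_primitive_lin (-1) 0 H H) _ r0.
  rewrite !mul0r !addr0 !mulN1r !oppr_le0; apply=> s _.
  by rewrite mul0r addr0 mulN1r oppr_le0; exact: phi_ge0.
have v_le r : 0 <= r -> v r <= (delta - 1) / (2 * n.+1%:R) * r ^+ 2.
  move=> r0; have [] := radial_primitive_le0 (radial_primitive_lin 1 (-1) H
    (const_radial_primitive n (delta - 1))) _ r0.
    by move=> s _; rewrite mul1r mulN1r subr_le0; exact: phi_le.
  by move=> _; rewrite mul1r mulN1r subr_le0.
have v_mono x y : 0 <= x -> x <= y -> v x <= v y.
  move=> x0 xy; apply: (derive_ge0_le xy (df := m)).
  - by move=> r /andP[xr _]; apply: dv; rewrite (le_trans x0)// ltW.
  - by move=> r /andP[xr _]; have [] := mv_ge0 r (le_trans x0 (ltW xr)).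
  - apply: continuous_segment => r /andP[xr _].
    exact: is_derive_continuous (dv r (le_trans x0 xr)).
(* Past the first zero of w, if any, w stays nonpositive and the truncation continues S by 0: this
   is the blow-up of T. *)
pose S (r : R) := Num.max (w `|r|) 0 `^ b.
have cabs (r : R) (f d : R -> R) : (forall t : R, 0 <= t -> is_derive t 1 f (d t)) ->
    {for r, continuous (fun t : R => f `|t|)}.
  move=> df; apply: (@continuous_comp _ _ _ (fun t : R => `|t|) f).
    exact: norm_continuous.
  exact: is_derive_continuous (df _ (normr_ge0 r)).
have dw (r : R) : 0 <= r -> is_derive r 1 w (- m r).
  by move=> r0; apply: (is_derive_lamB (is_derive_lamC 1 r) (dv r r0)); rewrite sub0r.
have S_gt0 r : 0 <= r -> 0 < S r -> 0 < w r.
  move=> r0; rewrite /S ger0_norm// => Sr; rewrite ltNge; apply/negP => w0.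
  by move: Sr; rewrite (max_idPr w0) powR0 ?ltxx// gt_eqF.
have SE r : 0 <= r -> 0 < w r -> S r = w r `^ b.
  by move=> r0 wr; rewrite /S ger0_norm// (max_idPl (ltW wr)).
have w_le1 r : 0 <= r -> w r <= 1.
  by move=> r0; have [_ ] := mv_ge0 r r0; rewrite /w; lra.
have [g [gE cg g0]] := (is_derive1_caratheodory _ _ _).1 dm0.
have {}gE z : m z = g z * z by have := gE z; rewrite m0 !subr0.
have dm' (r : R) : 0 <= r -> is_derive r 1 m (phi r - n%:R * g r).
  rewrite le_eqVlt => /orP[/eqP<-|r0].
    apply: (is_derive_eq dm0); rewrite g0 /phi -natr1; field.
    by rewrite natr1 gt_eqF.
  apply: (is_derive_eq (dm r r0)); rewrite gE mulfK ?gt_eqF//.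
  by rewrite -natr1 addrK.
(* T' and T'' for T = w^(-b), with w' = - m and w'' = n g - phi. All powers are expressed through
   w^b, which [field] treats as an atom. *)
pose P r := b * m r * (w r `^ b * w r)^-1.
pose Q r := b * (b + 1) * m r ^+ 2 * (w r `^ b * w r ^+ 2)^-1 +
  b * (phi r - n%:R * g r) * (w r `^ b * w r)^-1.
have dY (r : R) : 0 <= r -> 0 < w r ->
    is_derive r 1 (fun t => w t `^ b) (- (b * (w r `^ b / w r) * m r)).
  move=> r0 wr; apply: (is_derive_lam_comp (dw r r0) (is_derive1_powR b wr)).
  have wn : w r != 0 by rewrite gt_eqF.
  by rewrite powRB ?wn ?implybT// powRr1 ?(ltW wr)//; ring.
have Y0 r : 0 < w r -> w r `^ b != 0 by move=> wr; rewrite gt_eqF// powR_gt0.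
have phiE r : 0 <= r -> 0 < w r -> phi r = b^-1 * ((w r `^ b) ^+ 2 * w r).
  move=> r0 wr; rewrite /phi /F ger0_norm// clip_id; last first.
    by rewrite -/(w r) (ltW wr) w_le1.
  have wn : w r != 0 by rewrite gt_eqF.
  rewrite -/(w r) /p !powRD ?wn ?implybT// powRr1 ?(ltW wr)// /b invrK expr2; ring.
have w_at0 : w 0 = 1 by rewrite /w v0 subr0.
have dT (r : R) : 0 <= r -> 0 < w r ->
    is_derive r 1 (fun t => (Num.max (w t) 0 `^ b)^-1) (P r).
  move=> r0 wr.
  apply: (@is_derive_near _ (fun t => (w t `^ b)^-1)).
    have /continuous_dist /(_ _ wr)[d d0 hd] := is_derive_continuous (dw r r0).
    exists d => // t /hd; rewrite ltr_distl subrr => /andP[wt _].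
    by rewrite (max_idPl (ltW wt)).
  apply: (is_derive_lamV (dY r r0 wr) (Y0 r wr)).
  by rewrite /P; field; rewrite Y0//= gt_eqF.
exists S, P, Q; split; last first.
  pose rho : R := Num.sqrt (2 * n.+1%:R / (delta + 1)).
  have k0 : 0 < 2 * n.+1%:R / (delta + 1) by rewrite divr_gt0 ?mulr_gt0//; lra.
  have rho0 : 0 < rho by rewrite sqrtr_gt0.
  have rho2 : rho ^+ 2 = 2 * n.+1%:R / (delta + 1) by rewrite sqr_sqrtr// ltW.
  have y0 : 0 < 2 / (delta + 1) by rewrite divr_gt0//; lra.
  have wrho : 2 / (delta + 1) <= w rho.
    have := v_le rho (ltW rho0); rewrite rho2 /w.
    have -> : (delta - 1) / (2 * n.+1%:R) * (2 * n.+1%:R / (delta + 1)) =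
      (delta - 1) / (delta + 1).
      by field; rewrite !gt_eqF//=; lra.
    have -> : (delta - 1) / (delta + 1) = 1 - 2 / (delta + 1).
      by field; rewrite gt_eqF//; lra.
    lra.
  have wr0 := lt_le_trans y0 wrho.
  exists rho; split => //; first by rewrite SE ?(ltW rho0)// powR_gt0.
  rewrite lambda_lower_boundE// exprMn rho2 SE ?(ltW rho0)// ler_wpM2l ?(ltW k0)//.
  by rewrite ler_sqr ?nnegrE ?powR_ge0// ge0_ler_powR ?nnegrE ?(ltW b0) ?(ltW y0) ?(ltW wr0).
have wS r : 0 <= r -> 0 < S r -> 0 < w r by exact: S_gt0.
split.
- move=> r; apply: (@continuous_comp _ _ _ (fun t : R => w `|t|) (fun t => Num.max t 0 `^ b)).
    exact: (@cabs r _ _ dw).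
  exact: powR_max0_continuous.
- by rewrite SE ?w_at0 ?powR1.
- by move=> r; exact: powR_ge0.
- move=> x y x0 xy; have y0 := le_trans x0 xy.
  have wyx : w y <= w x by rewrite /w lerD2l lerN2 v_mono.
  rewrite /S !ger0_norm//; apply: ge0_ler_powR; rewrite ?nnegrE ?(ltW b0)//.
  - by rewrite le_max lexx orbT.
  - by rewrite le_max lexx orbT.
  - by rewrite ge_max !le_max wyx lexx orbT.
- move=> r r0 /(wS r r0) wr; move: r0; rewrite le_eqVlt => /orP[/eqP r0|r0].
    (* At 0 the even extension in S is differentiable because the slope vanishes. *)
    have P0 : P 0 = 0 by rewrite /P m0 mulr0 mul0r.
    rewrite -r0 P0.
    apply: (@is_derive_comp_abs0 R (fun t => (Num.max (w t) 0 `^ b)^-1)).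
    have w00 : 0 < w 0 by rewrite w_at0.
    exact: is_derive_eq (dT 0 (lexx 0) w00) P0.
  apply: is_derive_near (dT r (ltW r0) wr).
  exists r => // t; rewrite ltr_distl subrr => /andP[t0 _].
  by rewrite /S gtr0_norm.
- move=> r r0 /(wS r r0) wr.
  have h := is_derive_lamM (dY r r0 wr) (dw r r0) erefl.
  have yw : w r `^ b * w r != 0 by rewrite mulf_neq0 ?Y0// gt_eqF.
  apply: (is_derive_lamM (is_derive_lamZ (c := b) (dm' r r0) erefl) (is_derive_lamV h yw erefl)).
  by rewrite /Q; field; rewrite Y0//= gt_eqF.
- move=> r r0 /(wS r r0) wr.
  have cw : {for r, continuous (fun t => w `|t|)} by exact: (@cabs r _ _ dw).
  have cm : {for r, continuous (fun t => m `|t|)} by exact: (@cabs r _ _ dm').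
  have cgr : {for r, continuous (fun t => g `|t|)}.
    exact: quotient_continuous gE cg r0 (dm' r r0).
  have cphi : {for r, continuous (fun t => phi `|t|)}.
    have -> : (fun t : R => phi `|t|) = (fun t => F (v `|t|)).
      by apply/funext => t; rewrite /phi normr_id.
    apply: (@continuous_comp _ _ _ (fun t : R => v `|t|) F); first exact: (@cabs r _ _ dv).
    apply/continuous_dist => e e0; exists (e / ((delta - 1) * p)); first by rewrite divr_gt0.
    by move=> y; rewrite ltr_pdivlMr// mulrC; exact: le_lt_trans (FL y _).
  have cY : {for r, continuous (fun t => w `|t| `^ b)}.
    apply: (@continuous_comp _ _ _ (fun t : R => w `|t|) (fun t => t `^ b)) => //.
    by apply: is_derive_continuous (is_derive1_powR b _); rewrite ger0_norm.
  have wn : w `|r| != 0 by rewrite ger0_norm// gt_eqF.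
  have Yn : w `|r| `^ b != 0 by rewrite ger0_norm// Y0.
  have cc (k : R) : {for r, continuous (fun=> k)} by exact: cst_continuous.
  have csq (f : R -> R) : {for r, continuous f} -> {for r, continuous (fun t => f t ^+ 2)}.
    by move=> cf; exact: continuous_lamM.
  apply: continuous_lamD.
    apply: continuous_lamM; first by apply: continuous_lamM => //; exact: csq.
    apply: continuous_lamV; last by rewrite mulf_neq0 ?expf_neq0.
    by apply: continuous_lamM => //; exact: csq.
  apply: continuous_lamM.
    by apply: continuous_lamM => //; apply: continuous_lamB => //; exact: continuous_lamM.
  by apply: continuous_lamV; [exact: continuous_lamM|rewrite mulf_neq0].
- by rewrite /P m0 mulr0 mul0r.
- rewrite /Q m0 phiE ?lexx ?w_at0// powR1 g0 -/(phi 0) phiE ?lexx ?w_at0// powR1 -natr1.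
  by field; rewrite natr1 !gt_eqF.
- move=> r r0 Sr; have wr := wS r (ltW r0) Sr.
  rewrite SE ?(ltW r0)// /P /Q phiE ?(ltW r0)// gE dE -natr1 addrK.
  by field; rewrite Y0//= !gt_eqF.
Qed.

Theorem theorem1p2 (R : realType) (N : nat) (hN : (2 <= N)%N) :
  (forall mu1 : R, first_dirichlet_eigenvalue N mu1 ->
    0 < mu1 /\
    forall lambda delta : R, 0 < lambda -> 0 < delta ->
      (exists U : 'rV[R]_N -> R, regular_solution lambda delta U) ->
      lambda < Num.min (mu1 / 4) (mu1 / delta))
  /\
  (forall delta : R, N%:R / 2 <= delta ->
    exists lambdabar : R,
      [/\ 0 < lambdabar,
          forall lambda : R, 0 < lambda < lambdabar ->
            exactly_two (@radial_regular_solution R N lambda delta),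
          exactly_one (@radial_regular_solution R N lambdabar delta),
          forall lambda : R, lambdabar < lambda ->
            ~ exists U : 'rV[R]_N -> R, radial_regular_solution lambda delta U
        & lambda_lower_bound N delta <= lambdabar])
  /\
  (forall delta : R, delta = N%:R / 2 ->
    [/\ forall (lambda : R) (U : 'rV[R]_N -> R), 0 < lambda ->
          (radial_regular_solution lambda delta U <->
           exists alpha : R,
             [/\ 0 < alpha < 1,
                 lambda = 2 * N%:R * alpha * (1 - alpha)
               & forall x : 'rV[R]_N, closed_unit_ball x ->
                   U x = alpha * (1 - enorm x ^+ 2)]),
        forall lambda : R, 0 < lambda < N%:R / 2 ->
          exactly_two (@radial_regular_solution R N lambda delta),
        exactly_one (@radial_regular_solution R N (N%:R / 2) delta)
      & forall lambda : R, N%:R / 2 < lambda ->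
          ~ exists U : 'rV[R]_N -> R, radial_regular_solution lambda delta U]).
Proof.
have N0 : (0 < N)%N by exact: ltnW.
have NR : 2 <= N%:R :> R by rewrite ler_nat.
have part2 (delta : R) : N%:R / 2 <= delta ->
    exists lambdabar : R,
      [/\ 0 < lambdabar,
          forall lambda : R, 0 < lambda < lambdabar ->
            exactly_two (@radial_regular_solution R N lambda delta),
          exactly_one (@radial_regular_solution R N lambdabar delta),
          forall lambda : R, lambdabar < lambda ->
            ~ exists U : 'rV[R]_N -> R, radial_regular_solution lambda delta U
        & lambda_lower_bound N delta <= lambdabar].
  rewrite le_eqVlt => /orP[/eqP<-|dN].
    exact: profile_count hN (lexx _) (critical_profile_ode R N0) (critical_count_bound R hN).
  have d1 : 1 < delta by lra.
  have [S [P [Q [H hb]]]] := supercritical_profile N0 d1.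
  exact: profile_count hN (ltW dN) H hb.
split; [|split=> //].
  move=> mu1 [hmu _]; split; first exact: dirichlet_eigenvalue_gt0 hmu.
  move=> lambda delta l0 d0 [U hU].
  by rewrite lt_min (lambda_lt_mu_div4 l0 d0 hU hmu) (lambda_lt_mu_div_delta l0 d0 hU hmu).
move=> delta ->.
have [lb [lb0 two one none _]] := part2 (N%:R / 2) (lexx _).
(* The threshold of part (ii) is identified through the explicit family: 2 N alpha (1 - alpha) <= N
   / 2, with equality attained at alpha = 1 / 2. *)
suff lbE : lb = N%:R / 2.
  move: two one none; rewrite lbE => two one none.
  by split=> // lambda U l0; exact: critical_solutions.
have half0 : 0 < N%:R / 2 :> R by lra.
apply/eqP; rewrite eq_le; apply/andP; split.
  have [U [hU _]] := one.
  have [al [_ -> _]] := (critical_solutions U hN lb0).1 hU.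
  have : 0 <= N%:R * (2 * al - 1) ^+ 2 :> R by rewrite mulr_ge0 ?sqr_ge0 ?ler0n.
  nra.
rewrite leNgt; apply/negP => /none; apply.
exists (fun x => 2^-1 * (1 - enorm x ^+ 2)).
apply/(critical_solutions _ hN half0); exists 2^-1; split=> //.
- by apply/andP; split; lra.
- by field.
Qed.
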